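(* With probability one there exists $n_0$ such that for every $n\ge n_0$ the function $\mathbb R^4\ni(\alpha',\mu'_\varepsilon,\theta_1',\theta_2')\mapsto Q_n(\mathbf Y_n;\alpha',\mu'_\varepsilon,\theta_1',\theta_2')$ has a unique global minimizer, denoted $(\hat\alpha_n,\hat\mu_{\varepsilon,n},\hat\theta_{1,n},\hat\theta_{2,n})$. Moreover, for every $(\alpha,\mu_\varepsilon,\theta_1,\theta_2)\in(0,1)\times(0,\infty)\times\mathbb N^2$, almost surely $\hat\alpha_n\to\alpha$, $\hat\mu_{\varepsilon,n}\to\mu_\varepsilon$ and, for $i=1,2$, $$\hat\theta_{i,n}\to Y_{s_i}-\frac{\alpha}{1+\alpha^2}(Y_{s_i-1}+Y_{s_i+1})-\frac{1-\alpha}{1+\alpha^2}\mu_\varepsilon .$$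
   Context: INAR(1) process: Let $\alpha\in(0,1)$. Let $(\varepsilon_k)_{k\in\mathbb N}$ be i.i.d. non-negative integer-valued random variables with $\mathbb E\varepsilon_1^2<\infty$ and $\mathbb P(\varepsilon_1\ne 0)>0$; write $\mu_\varepsilon=\mathbb E\varepsilon_1$. For each $k\in\mathbb N$ let $(\xi_{k,j})_{j\in\mathbb N}$ be i.i.d. Bernoulli random variables with mean $\alpha$, these sequences being mutually independent and independent of $(\varepsilon_k)$. Let $X_0$ be a non-negative integer-valued random variable with $\mathbb E X_0^2<\infty$, independent of all $\xi_{k,j}$ and $\varepsilon_k$, and set $X_k=\sum_{j=1}^{X_{k-1}}\xi_{k,j}+\varepsilon_k$ for $k\in\mathbb N$. Two non-neighbouring additive outliers: fix known $s_1,s_2\in\mathbb N$ with $s_1<s_2-1$ and $\theta_1,\theta_2\in\mathbb N$; $Y_k=X_k+\delta_{k,s_1}\theta_1+\delta_{k,s_2}\theta_2$, $k\in\mathbb Z_+$; $\mathbf Y_n=(Y_0,\dots,Y_n)$. For $n\ge\max(5,s_2+1)$, $$Q_n(\mathbf y_n;\alpha',\mu'_\varepsilon,\theta_1',\theta_2')=\sum_{\substack{k=1\\k\notin\{s_1,s_1+1,s_2,s_2+1\}}}^n(y_k-\alpha'y_{k-1}-\mu'_\varepsilon)^2+\sum_{i=1}^2\Big[(y_{s_i}-\alpha'y_{s_i-1}-\mu'_\varepsilon-\theta_i')^2+(y_{s_i+1}-\alpha'y_{s_i}-\mu'_\varepsilon+\alpha'\theta_i')^2\Big].$$ *)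

(* Defs.v *)
From HB Require Import structures.
From mathcomp Require Import all_boot all_order all_algebra.
From mathcomp Require Import all_classical all_reals all_analysis.
From Stdlib Require Lists.List.
Set Implicit Arguments. Unset Strict Implicit. Unset Printing Implicit Defensive.
Import Order.TTheory GRing.Theory Num.Theory.
Import numFieldNormedType.Exports.
Local Open Scope classical_set_scope.
Local Open Scope ring_scope.

Inductive inar_idx := IX0 | IEps of nat | IXi of nat & nat.

Definition inar_used : set inar_idx :=
  fun i => match i with
           | IX0 => True
           | IEps k => (1 <= k)%N
           | IXi k j => (1 <= k)%N /\ (1 <= j)%N
           end.

(* Mutual independence of a family of nat-valued random variables
   (indexed by the elements of S): product rule for every finite
   subfamily of distinct indices and every choice of (measurable,
   i.e. arbitrary, since nat is discrete) sets. *)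
Definition mutually_independent d (T : measurableType d) (R : realType)
  (P : probability T R) (I : Type) (S : set I) (F : I -> T -> nat) : Prop :=
  forall (J : seq I) (A : I -> set nat),
    Stdlib.Lists.List.NoDup J -> (forall i, Stdlib.Lists.List.In i J -> S i) ->
    P (\bigcap_(i in [set i | Stdlib.Lists.List.In i J]) (F i @^-1` A i)) =
    (\prod_(i <- J) P (F i @^-1` A i))%E.

Definition inar_family (T : Type) (X0 : T -> nat) (eps : nat -> T -> nat)
  (xi : nat -> nat -> T -> nat) : inar_idx -> T -> nat :=
  fun i => match i with
           | IX0 => X0
           | IEps k => eps k
           | IXi k j => xi k j
           end.

Fixpoint inarX (T : Type) (X0 : T -> nat) (eps : nat -> T -> nat)
  (xi : nat -> nat -> T -> nat) (k : nat) (w : T) : nat :=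
  match k with
  | 0 => X0 w
  | k'.+1 => (\sum_(j < inarX X0 eps xi k' w) xi k'.+1 j.+1 w + eps k'.+1 w)%N
  end.

Definition inarY (T : Type) (X0 : T -> nat) (eps : nat -> T -> nat)
  (xi : nat -> nat -> T -> nat) (s1 s2 th1 th2 : nat) (k : nat) (w : T) : nat :=
  (inarX X0 eps xi k w + (if k == s1 then th1 else 0)
                       + (if k == s2 then th2 else 0))%N.

(* Parameter vector (alpha', mu', theta1', theta2') stored as
   (((alpha', mu'), theta1'), theta2'). *)
Definition par4 (R : Type) := (R * R * R * R)%type.

Definition Qn (R : realType) (s1 s2 n : nat) (y : nat -> R) (p : par4 R) : R :=
  let a := p.1.1.1 in let m := p.1.1.2 in
  let t1 := p.1.2 in let t2 := p.2 in
  \sum_(1 <= k < n.+1 | k \notin [:: s1; s1.+1; s2; s2.+1])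
      (y k - a * y k.-1 - m) ^+ 2
  + ((y s1 - a * y s1.-1 - m - t1) ^+ 2 + (y s1.+1 - a * y s1 - m + a * t1) ^+ 2)
  + ((y s2 - a * y s2.-1 - m - t2) ^+ 2 + (y s2.+1 - a * y s2 - m + a * t2) ^+ 2).

(* Main.v *)
(* The residuals x_{k+1} - alpha x_k - mu of the chain are controlled without an
   ergodic theorem.  For a function G of two consecutive states whose conditional
   mean given the first one is nonpositive, products of exp(t G - O(t^2) Var G)
   along the chain have expectation at most 1, so Markov's inequality bounds the
   partial sums of G at every large time.  Two moments of the innovations suffice,
   because the large positive values of G can be dropped: almost surely they do
   not occur for the step sizes t = t_n in use.  This shows that the sums of the
   residuals, plain and weighted by x_k, are negligible with respect to n and
   n + sum x_k^2; the same inequality applied to the jumps of the integer-valued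
   chain bounds the empirical variance of x_0, ..., x_n from below.

   The rest is deterministic.  The four excluded terms only perturb an ordinary
   regression: comparing a minimizer with well chosen parameters gives convergence
   of the slope, then of the intercept, and theta_i is an explicit function of
   these two.  The criterion is not convex, but for large n the growing quadratic
   part beats the bounded midpoint-convexity defect of the outlier terms, whence
   uniqueness. *)
Require Import Defs.
From HB Require Import structures.
From mathcomp Require Import all_boot all_order all_algebra.
From mathcomp Require Import all_classical all_reals all_analysis.
From mathcomp Require Import measurable_realfun.
From mathcomp Require Import ring lra zify.
Import Order.TTheory GRing.Theory Num.Theory.
Import numFieldNormedType.Exports.
Local Open Scope classical_set_scope.
Local Open Scope ring_scope.
Set Implicit Arguments. Unset Strict Implicit. Unset Printing Implicit Defensive.

(** * Integrals of nat-valued variables *)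

(** No conditional expectation is formed: a nonnegative weight [W] carried by the past plays the
    role of a density, and conditioning on an event is multiplication by its indicator. Independence
    becomes a statement about integrals that passes from one time to the next. The sum of [x_k^2] is
    never bounded by a multiple of [n], and the conditional variance of [x_k] times its residual is
    even cubic in [x_k]. One power of [x_k] is paid for by its almost sure growth rate, and the rest
    is compared with [n + sum x_k^2]. This is in turn dominated by the centred sum of squares [V n],
    the curvature of the criterion in the slope, because [sum x_k = O(n)] and [V n >= v * n]. Large
    values of the chain thus increase the error and the curvature together. The step sizes depend on
    the horizon [n], so each [n] has its own product of exponentials; summability of [rho n ^- 48]
    joins these bounds into one almost sure statement. *)

Section NatValued.
Context d (T : measurableType d) (R : realType).

(** The number of summands in one generation is random; a countable partition by the value of [N]
    reduces measurability to deterministic indices. *)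
Lemma measurable_freeze d' (U : measurableType d') (N : T -> nat)
    (G : nat -> T -> U) : measurable_fun setT N ->
  (forall n, measurable_fun setT (G n)) ->
  measurable_fun setT (fun w => G (N w) w).
Proof.
move=> mN mG _ B mB; rewrite setTI.
have -> : (fun w => G (N w) w) @^-1` B =
    \bigcup_n (N @^-1` [set n] `&` G n @^-1` B).
  apply/seteqP; split=> [w Bw|w [n _ [/= <-]]//]; by exists (N w).
apply: bigcup_measurable => n _; apply: measurableI.
  by have := mN measurableT [set n] I; rewrite setTI.
by have := mG n measurableT B mB; rewrite setTI.
Qed.

Lemma measurable_nat_comp d' (U : measurableType d') (N : T -> nat)
    (g : nat -> U) : measurable_fun setT N -> measurable_fun setT (g \o N).
Proof. by move=> mN; apply: (measurable_freeze mN (G := fun n _ => g n)). Qed.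

Lemma measurable_preimage_nat (N : T -> nat) (B : set nat) :
  measurable_fun setT N -> measurable (N @^-1` B).
Proof. by move=> mN; have := mN measurableT B I; rewrite setTI. Qed.

Lemma nneseries_single (n : nat) (a : \bar R) :
  (0 <= a)%E -> \big[+%E/0%E]_(0 <= k <oo) (a * (n == k)%:R%:E)%E = a.
Proof.
move=> a0; have h k : (0 <= a * (n == k)%:R%:E)%E.
  by rewrite mule_ge0// lee_fin.
rewrite (@nneseriesD1 _ _ n)//= eqxx mule1 eseries_cond eseries0 ?adde0//.
by move=> k _ /=; rewrite eq_sym; case: eqP; rewrite ?mule0.
Qed.

(** The factor may be [+oo]: it is applied to the total mass of a weight, which is not assumed
    finite. *)
Lemma nneseriesMl (a : \bar R) (f : nat -> \bar R) :
  (0 <= a)%E -> (forall n, (0 <= f n)%E) ->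
  \big[+%E/0%E]_(0 <= k <oo) (a * f k)%E = (a * \big[+%E/0%E]_(0 <= k <oo) f k)%E.
Proof.
case: a => [r| |]// r0 f0; first exact: nneseriesZl.
have [[n fn0]|/forallNP fE] := pselect (exists n, f n != 0%E); last first.
  have {}fE n : f n = 0%E by apply/eqP; apply: contrapT => /negP; exact: fE.
  by rewrite !eseries0 ?mule0// => n _ _; rewrite fE ?mule0.
rewrite (@eseries_pinfty _ _ _ n)//; last 2 first.
- by move=> k _; rewrite gt_eqF// (lt_le_trans (ltNyr 0))// mule_ge0.
- by rewrite gt0_mulye// lt0e fn0 f0.
rewrite gt0_mulye//; have := nneseries_lim_ge n.+1 (fun k _ _ => f0 k) (m := 0) (P := xpredT).
apply: lt_le_trans; rewrite big_nat_recr//= lt0e padde_eq0 ?sume_ge0//.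
by rewrite (negPf fn0) andbF adde_ge0 ?sume_ge0.
Qed.

Context (P : probability T R).

Lemma integral_split_nat (N : T -> nat) (G : T -> \bar R) :
  measurable_fun setT N -> measurable_fun setT G -> (forall w, (0 <= G w)%E) ->
  (\int[P]_w G w = \big[+%E/0%E]_(0 <= n <oo) \int[P]_w (G w * (N w == n)%:R%:E))%E.
Proof.
move=> mN mG G0; rewrite -integral_nneseries//.
- by apply: eq_integral => w _; rewrite nneseries_single.
- move=> n; apply: emeasurable_funM => //.
  exact: (measurable_nat_comp (fun m => (m == n)%:R%:E) mN).
- by move=> n w _; rewrite mule_ge0 ?lee_fin.
Qed.

Lemma integral_nat_indic (N : T -> nat) (B : set nat) : measurable_fun setT N ->
  (\int[P]_w (\1_B (N w))%:E)%E = P (N @^-1` B).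
Proof.
move=> mN; have mB := measurable_preimage_nat B mN.
by rewrite -[in RHS](setIT (N @^-1` B)) -integral_indic.
Qed.

End NatValued.

(** * Polynomial growth almost surely *)

Section Growth.
Context (R : realType).

(* A common scale for all rates: [n + 1 = rho ^ 40], the almost sure bounds are
   of order [rho ^ 48] (summable inverses), so that [1 + x_k = O(rho ^ 24)] and
   the residuals times [1 + x_k] are [O(rho ^ 36)], which is [o(rho ^ 38)] for
   step sizes [rho ^- 38]. *)
Definition rho (n : nat) : R := n.+1%:R `^ (40%:R^-1).

Lemma rhoX40 n : rho n ^+ 40 = n.+1%:R.
Proof. by rewrite /rho -powR_mulrn ?powR_ge0// -powRrM mulVf// powRr1. Qed.

Lemma rho_ge1 n : 1 <= rho n.
Proof. by rewrite /rho -[leLHS](powRr0 n.+1%:R) ler_powR// ler1n. Qed.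

Lemma rho_gt0 n : 0 < rho n.
Proof. exact: lt_le_trans (rho_ge1 n). Qed.

Lemma le_rho m n : (m <= n)%N -> rho m <= rho n.
Proof. by move=> mn; rewrite /rho ge0_ler_powR ?nnegrE// ler_nat. Qed.

(** Discrete form of integrating [t^(-6/5)]. With [p], [q] the fifth roots of [n + 1] and [n + 2],
    factoring [q^5 - p^5 = 1] gives [q - p >= 1 / (5 q^4)], hence [q^-6 <= 5/p - 5/q], and the bound
    telescopes. *)
Lemma sum_rhoV n : \sum_(k < n.+1) (rho k ^+ 48)^-1 <= 6 - 5 / rho n ^+ 8.
Proof.
elim: n => [|n IH].
  rewrite big_ord1 (_ : rho 0 = 1); last by rewrite /rho powR1.
  by rewrite !expr1n; lra.
rewrite big_ord_recr /=; apply: le_trans (lerD IH (lexx _)) _.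
set p := rho n ^+ 8; set q := rho n.+1 ^+ 8.
have p1 : 1 <= p by rewrite exprn_ege1// rho_ge1.
have pq : p <= q by rewrite lerXn2r ?nnegrE ?(ltW (rho_gt0 _))// le_rho.
have pq5 : q ^+ 5 = p ^+ 5 + 1 by rewrite -!exprM !rhoX40 -natr1.
have p0 : 0 < p by lra. have q0 : 0 < q by lra.
rewrite (_ : rho n.+1 ^+ 48 = q ^+ 6); last by rewrite -exprM.
have h : 1 <= 5 * (q - p) * q ^+ 4.
  have h k : p ^+ k <= q ^+ k by rewrite lerXn2r ?nnegrE ?(ltW p0) ?(ltW q0).
  have qk k : 0 <= q ^+ k by rewrite exprn_ge0 ?(ltW q0).
  have q3 : q ^+ 3 * p <= q ^+ 4 by rewrite [leRHS]exprSr; exact: ler_wpM2l.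
  have q2 : q ^+ 2 * p ^+ 2 <= q ^+ 4.
    by rewrite (_ : q ^+ 4 = q ^+ 2 * q ^+ 2); [exact: ler_wpM2l|ring].
  have q1 : q * p ^+ 3 <= q ^+ 4 by rewrite [leRHS]exprS; apply: ler_wpM2l => //; exact: ltW.
  pose S := q ^+ 4 + q ^+ 3 * p + q ^+ 2 * p ^+ 2 + q * p ^+ 3 + p ^+ 4.
  have e : (q - p) * S = 1 by transitivity (q ^+ 5 - p ^+ 5); [rewrite /S; ring|rewrite pq5; ring].
  rewrite -[leLHS]e (_ : 5 * (q - p) * q ^+ 4 = (q - p) * (5 * q ^+ 4)); last by ring.
  by apply: ler_wpM2l; rewrite ?subr_ge0// /S; have := h 4; lra.
have -> : 6 - 5 / p + (q ^+ 6)^-1 = 6 - 5 / q - (5 * (q - p) * q ^+ 5 - p) / (p * q ^+ 6).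
  by field; rewrite !gt_eqF.
rewrite gerBl; apply: divr_ge0; last first.
  by apply: mulr_ge0; [exact: ltW|apply: exprn_ge0; exact: ltW].
rewrite subr_ge0; apply: (le_trans pq); rewrite exprSr mulrA.
by rewrite ler_peMl// ltW.
Qed.

(** From [expR (- u) >= 1 - u] and [(1 + u + 2 u^2)(1 - u) = 1 + u^2 (1 - 2 u) >= 1]. It holds for
    arbitrarily negative [u], which is why [trunc_half] cuts on one side only. *)
Lemma expR_le_quad (u : R) : u <= 1 / 2 -> expR u <= 1 + u + 2 * u ^+ 2.
Proof.
move=> u12; have h := expR_ge1Dx (- u).
have u1 : 0 < 1 - u by lra.
have : expR u * (1 - u) <= expR u * expR (- u) by rewrite ler_wpM2l ?expR_ge0.
rewrite -expRD subrr expR0 => /le_trans h1; rewrite -(ler_pM2r u1); apply: h1.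
nra.
Qed.

(* Dropping large positive deviations keeps the exponential moments of the
   supermartingale finite with only two moments of [eps]. *)
Definition trunc_half (u : R) := if u <= 1 / 2 then u else 0.

(** The series of [f n / rho n ^ 48] has finite expectation, hence is almost surely finite. Its sum
    serves as the random constant [C], valid for all [n] at once, since it dominates each of its
    terms. *)
Lemma ae_growth d (T : measurableType d) (P : probability T R) (f : nat -> T -> R) (c : R) :
  (forall n, measurable_fun setT (f n)) -> (forall n w, 0 <= f n w) ->
  (forall n, (\int[P]_w (f n w)%:E <= c%:E)%E) ->
  {ae P, forall w, exists C : R, forall n, f n w <= C * rho n ^+ 48}.
Proof.
move=> mf f0 fc.
have r0 n : 0 < (rho n ^+ 48)^-1 by rewrite invr_gt0 exprn_gt0// rho_gt0.
have c0 : 0 <= c.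
  by rewrite -lee_fin (le_trans _ (fc 0%N))// integral_ge0// => w _; rewrite lee_fin.
pose g n w := (((rho n ^+ 48)^-1)%:E * (f n w)%:E)%E.
have g0 n w : (0 <= g n w)%E by rewrite mule_ge0// lee_fin// ltW.
have mg n : measurable_fun setT (g n).
  by apply: emeasurable_funM => //; exact/measurable_EFinP.
pose s w := (\big[+%E/0]_(0 <= n <oo) g n w)%E.
have ms : measurable_fun setT s.
  exact: (ge0_emeasurable_sum (fun n w _ _ => g0 n w) (fun n _ => mg n)).
have s0 w : (0 <= s w)%E by apply: nneseries_ge0.
have sum_s : (\int[P]_w s w <= (c * 6)%:E)%E.
  rewrite integral_nneseries//.
  apply: lime_le; first by apply: is_cvg_nneseries => n _ _; exact: integral_ge0.
  apply: nearW => n.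
  apply: (@le_trans _ _ (\sum_(0 <= k < n) (c * (rho k ^+ 48)^-1)%:E)%E).
    apply: lee_sum => k _; rewrite /g ge0_integralZl_EFin//; last 3 first.
    - by move=> w _; rewrite lee_fin.
    - exact/measurable_EFinP.
    - exact: ltW.
    rewrite [(c * _)%R]mulrC EFinM; apply: lee_wpmul2l; last exact: fc.
    by rewrite lee_fin ltW.
  rewrite sumEFin -mulr_sumr lee_fin ler_wpM2l//.
  case: n => [|n]; first by rewrite big_geq.
  rewrite big_mkord; apply: le_trans (sum_rhoV n) _.
  by rewrite gerBl divr_ge0// exprn_ge0// ltW// rho_gt0.
have int_s : P.-integrable setT s.
  apply/integrableP; split=> //.
  under eq_integral do rewrite gee0_abs//.
  exact: le_lt_trans sum_s (ltry _).
apply: filterS (integrable_ae measurableT int_s) => w /(_ I) sfin.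
exists (fine (s w)) => n.
rewrite -ler_pdivrMr; last by rewrite exprn_gt0// rho_gt0.
rewrite mulrC -lee_fin fineK//.
have := nneseries_lim_ge n.+1 (fun k _ _ => g0 k w) (m := 0) (P := xpredT).
apply: le_trans; rewrite big_nat_recr//= leeDr// sume_ge0//.
Qed.

End Growth.

(** * Independence as a property of weights *)

Section Independence.
Context d (T : measurableType d) (R : realType) (P : probability T R).
Variables (I : Type) (F : I -> T -> nat).
Hypothesis mF : forall i, measurable_fun setT (F i).

Definition cyl (J : seq I) (A : I -> set nat) (w : T) : R :=
  \prod_(i <- J) \1_(A i) (F i w).

(* The finite measure [W P] makes the variables indexed by [S] independent of
   [W], with the same joint law as under [P]. *)
Definition indepW (S : set I) (W : T -> \bar R) : Prop :=
  [/\ measurable_fun setT W, (forall w, (0 <= W w)%E) &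
      forall (J : seq I) (A : I -> set nat),
        List.NoDup J -> (forall i, List.In i J -> S i) ->
        (\int[P]_w (W w * (cyl J A w)%:E) =
         \int[P]_w W w * \prod_(i <- J) P (F i @^-1` A i))%E].

Lemma measurable_1nat (i : I) (B : set nat) :
  measurable_fun setT (fun w => (\1_B (F i w) : R)).
Proof. exact: (measurable_nat_comp (fun n => \1_B n : R) (mF i)). Qed.

Lemma measurable_cyl J A : measurable_fun setT (cyl J A).
Proof.
elim: J => [|i J IH].
  by rewrite (_ : cyl [::] A = cst 1) //; apply/funext => w; rewrite /cyl big_nil.
rewrite (_ : cyl (i :: J) A = fun w => \1_(A i) (F i w) * cyl J A w); last first.
  by apply/funext => w; rewrite /cyl big_cons.
by apply: measurable_funM => //; exact: measurable_1nat.
Qed.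

Lemma cyl_ge0 J A w : 0 <= cyl J A w.
Proof. by rewrite /cyl; apply: prodr_ge0 => i _; rewrite indicE. Qed.

Lemma cyl_bigcap J A w :
  cyl J A w = \1_(\bigcap_(i in [set i | List.In i J]) (F i @^-1` A i)) w.
Proof.
elim: J => [|i J IH].
  by rewrite /cyl big_nil indicE mem_set.
rewrite /cyl big_cons -[X in _ * X]/(cyl J A w).
rewrite IH !indicE -natrM mulnb.
congr (nat_of_bool _)%:R; apply/andP/idP; rewrite !inE.
  by move=> [Ai AJ] j /= [<-//|]; exact: AJ.
by move=> AJ; split=> [|j jJ]; apply: AJ => /=; [left|right].
Qed.

Lemma indepW1 (S : set I) : mutually_independent P S F -> indepW S (cst 1%E).
Proof.
move=> indF; split => // J A JN JS.
rewrite integral_cst// [X in (1 * X * _)%E](probability_setT P) mule1 mul1e -indF//.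
under eq_integral do rewrite mul1e cyl_bigcap.
have mJ : measurable (\bigcap_(i in [set i | List.In i J]) (F i @^-1` A i)).
  have m1 := measurable_cyl J A; rewrite (funext (cyl_bigcap J A)) in m1.
  have := m1 measurableT [set 1] (measurable_set1 1); rewrite setTI.
  congr (measurable _); apply/seteqP; split=> w /=; rewrite indicE.
    by case: (boolP (w \in _)) => [/set_mem//|_ /esym/eqP]; rewrite oner_eq0.
  by move=> h; rewrite mem_set.
by rewrite integral_indic// setIT.
Qed.

Lemma sub_indepW (S S' : set I) W : S' `<=` S -> indepW S W -> indepW S' W.
Proof. by move=> sub [mW W0 WJ]; split=> // J A JN JS; apply: WJ => // i /JS /sub. Qed.

(** Unnormalised conditioning on [F i] lying in [B]. It uses up the index [i], which therefore
    leaves [S]. *)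
Lemma indepW_restrict (S : set I) W i B : S i -> indepW S W ->
  indepW (S `\ i) (fun w => W w * (\1_B (F i w))%:E)%E /\
  (\int[P]_w (W w * (\1_B (F i w))%:E) = \int[P]_w W w * P (F i @^-1` B))%E.
Proof.
move=> Si [mW W0 WJ].
have E1 : (\int[P]_w (W w * (\1_B (F i w))%:E) = \int[P]_w W w * P (F i @^-1` B))%E.
  have := WJ [:: i] (fun=> B); rewrite big_seq1 => <-.
  - by apply: eq_integral => w _; rewrite /cyl big_seq1.
  - by apply: List.NoDup_cons => //; exact: List.NoDup_nil.
  - by move=> j /= [<-|].
split=> //; split.
- apply: emeasurable_funM => //; apply/measurable_EFinP; exact: measurable_1nat.
- by move=> w; rewrite mule_ge0// lee_fin indicE.
move=> J A JN JS; rewrite E1 -muleA.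
(* The index [i] does not occur in [J], so forcing the value [B] at [i] leaves the cylinder over [J]
   unchanged, and the product rule applies to [i :: J]. *)
pose A' j := if pselect (j = i) then B else A j.
have A'i : A' i = B by rewrite /A'; case: pselect.
have iJ : ~ List.In i J by move=> /JS [_] /(_ erefl).
have A'J j : List.In j J -> A' j = A j.
  by move=> jJ; rewrite /A'; case: pselect => // ji; case: iJ; rewrite -ji.
have ext (V : Type) (op : V -> V -> V) (x : V) (f g : I -> V) K :
    (forall j, List.In j K -> f j = g j) ->
    \big[op/x]_(j <- K) f j = \big[op/x]_(j <- K) g j.
  elim: K => [|k K IH] fg; first by rewrite !big_nil.
  by rewrite !big_cons fg ?IH//=; [move=> j jK; apply: fg; right|left].
have := WJ (i :: J) A'; rewrite big_cons A'i.
rewrite (ext _ _ _ (fun j => P (F j @^-1` A' j)) (fun j => P (F j @^-1` A j)) J); last first.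
  by move=> j /A'J ->.
move=> <-; last 2 first.
- exact: List.NoDup_cons.
- by move=> j /= [<-//|/JS[]].
apply: eq_integral => w _; rewrite -muleA -EFinM /cyl big_cons A'i; congr (_ * (_ * _)%:E)%E.
by apply: ext => j /A'J ->.
Qed.

Lemma indepW_cyl (S : set I) W J A : List.NoDup J -> (forall i, List.In i J -> S i) ->
  indepW S W -> indepW (S `\` [set i | List.In i J]) (fun w => W w * (cyl J A w)%:E)%E.
Proof.
elim: J S W => [|i J IH] S W JN JS indW.
  rewrite (_ : (fun _ => _) = W); first by apply: sub_indepW indW => i [].
  by apply/funext => w; rewrite /cyl big_nil mule1.
have [iJ JN'] : ~ List.In i J /\ List.NoDup J by apply/List.NoDup_cons_iff.
have [indWi _] := indepW_restrict (A i) (JS i (or_introl erefl)) indW.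
have := IH (S `\ i) _ JN' _ indWi.
rewrite (_ : (fun w => _) = (fun w => W w * (cyl (i :: J) A w)%:E)%E); last first.
  by apply/funext => w; rewrite /cyl big_cons EFinM muleA.
move=> h; apply: sub_indepW (h _).
  move=> j [Sj /= /not_orP[ij jJ]]; split => //; split => // ji; exact: ij.
by move=> j jJ; split; [apply: JS; right|move=> /= ji; apply: iJ; rewrite -ji].
Qed.

End Independence.

(** * The INAR(1) chain as a Markov chain *)

Section Chain.
Context d (T : measurableType d) (R : realType) (P : probability T R).
Variables (alpha : R) (X0 : T -> nat) (eps : nat -> T -> nat)
  (xi : nat -> nat -> T -> nat).
Let F := inar_family X0 eps xi.
Let X := inarX X0 eps xi.
Hypothesis alpha01 : 0 < alpha < 1.
Hypothesis mF : forall i, measurable_fun setT (inar_family X0 eps xi i).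
Hypothesis indF : mutually_independent P inar_used (inar_family X0 eps xi).
Hypothesis eps_id : forall k (A : set nat), (1 <= k)%N ->
  P (eps k @^-1` A) = P (eps 1%N @^-1` A).
Hypothesis xi_law : forall k j, (1 <= k)%N -> (1 <= j)%N ->
  P (xi k j @^-1` [set 1%N]) = alpha%:E /\
  P (xi k j @^-1` [set 0%N]) = (1 - alpha)%:E.

Definition idx_time (i : inar_idx) : nat :=
  match i with IX0 => 0 | IEps k => k | IXi k _ => k end.

Definition used_from n : set inar_idx :=
  [set i | inar_used i /\ (n <= idx_time i)%N].

Definition next_gen k x w := (\sum_(j < x) xi k j.+1 w + eps k w)%N.

(* [kernel x h] is the expectation of [h] under the one-step transition law
   of the chain from state [x]. *)
Fixpoint kernel (x : nat) (h : nat -> \bar R) : \bar R :=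
  match x with
  | 0 => \int[P]_w h (eps 1%N w)
  | x'.+1 => alpha%:E * kernel x' (h \o succn) + (1 - alpha)%:E * kernel x' h
  end%E.

Lemma inarXS k w : X k.+1 w = next_gen k.+1 (X k w) w.
Proof. by []. Qed.

Lemma measurable_next_gen k x : measurable_fun setT (next_gen k x).
Proof.
elim: x => [|x IH].
  rewrite (_ : next_gen k 0 = F (IEps k)); first exact: mF.
  by apply/funext => w; rewrite /next_gen big_ord0.
rewrite (_ : next_gen k x.+1 = fun w => (fun n w => xi k x.+1 w + n)%N (next_gen k x w) w); last first.
  by apply/funext => w; rewrite /next_gen big_ord_recr/= addnAC addnC.
apply: (measurable_freeze IH (G := fun n w => (xi k x.+1 w + n)%N)) => n.
exact: (measurable_nat_comp (fun m => m + n)%N (mF (IXi k x.+1))).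
Qed.

Lemma measurable_inarX k : measurable_fun setT (X k).
Proof.
elim: k => [|k IH]; first exact: (mF IX0).
exact: (measurable_freeze IH (measurable_next_gen k.+1)).
Qed.

Lemma kernel_ge0 x h : (forall n, (0 <= h n)%E) -> (0 <= kernel x h)%E.
Proof.
have [a0 a1] := andP alpha01.
elim: x h => [|x IH] h h0 /=; first by apply: integral_ge0 => w _; exact: h0.
by apply: adde_ge0; apply: mule_ge0; rewrite ?lee_fin ?subr_ge0 ?(ltW a0) ?(ltW a1)//; apply: IH => n; exact: h0.
Qed.

Lemma xi01 k j : (1 <= k)%N -> (1 <= j)%N ->
  {ae P, forall w, xi k j w = 0%N \/ xi k j w = 1%N}.
Proof.
move=> k1 j1; have [P1 P0] := xi_law k1 j1.
have mxi B : measurable (xi k j @^-1` B).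
  exact: (measurable_preimage_nat B (mF (IXi k j))).
have PU : P (xi k j @^-1` [set 1%N] `|` xi k j @^-1` [set 0%N]) = 1%E.
  rewrite measureU//; first by rewrite [X in (X + _)%E]P1 [X in (_ + X)%E]P0 -EFinD addrC subrK.
  by apply/seteqP; split=> // w [/= ->].
exists (~` (xi k j @^-1` [set 1%N] `|` xi k j @^-1` [set 0%N])); split.
- by apply: measurableC; exact: measurableU.
- by rewrite probability_setC ?PU ?subee//; exact: measurableU.
- by move=> w /= xiw [w1|w0]; apply: xiw; [right|left].
Qed.

(** One-step Markov property from a frozen state [x], by induction on [x]: splitting on the value of
    the last Bernoulli variable gives two weights still independent of the remaining ones, matching
    the two terms of [kernel]. *)
Lemma indepW_next_gen k x h S W : (1 <= k)%N -> (forall n, (0 <= h n)%E) ->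
  indepW P (inar_family X0 eps xi) S W -> S (IEps k) ->
  (forall j, (j < x)%N -> S (IXi k j.+1)) ->
  (\int[P]_w (W w * h (next_gen k x w)) = \int[P]_w W w * kernel x h)%E.
Proof.
move=> k1; elim: x h S W => [|x IH] h S W h0 indW Seps Sxi /=.
  (* The integral of [h (eps i)] depends only on the point masses. Using this for [W] at time [k]
     and for the constant weight at time 1 gives the same series, which identifies the two sides. *)
  have base i (V : T -> \bar R) (c : \bar R) : (0 <= c)%E -> measurable_fun setT V ->
      (forall w, (0 <= V w)%E) ->
      (forall n, \int[P]_w (V w * (\1_[set n] (eps i w))%:E) =
         c * P (eps 1%N @^-1` [set n]))%E ->
      (\int[P]_w (V w * h (eps i w)) =
         c * \big[+%E/0]_(0 <= n <oo) (h n * P (eps 1%N @^-1` [set n])))%E.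
    move=> c0 mV V0 Vn; rewrite (integral_split_nat P (mF (IEps i))); last 2 first.
    - by apply: emeasurable_funM => //; exact: (measurable_nat_comp h (mF (IEps i))).
    - by move=> w; rewrite mule_ge0.
    rewrite -nneseriesMl//; last by move=> n; rewrite mule_ge0.
    apply: eq_eseriesr => n _.
    transitivity (h n * \int[P]_w (V w * (\1_[set n] (eps i w))%:E))%E; last first.
      by rewrite Vn muleCA.
    rewrite -ge0_integralZl//; last 2 first.
    - apply: emeasurable_funM => //.
      exact: (measurable_nat_comp (fun m => (\1_[set n] m)%:E) (mF (IEps i))).
    - by move=> w _; rewrite mule_ge0// lee_fin indicE.
    apply: eq_integral => w _; rewrite indicE classical_sets.in_set1 /=.
    by case: eqP => [->|_]; rewrite ?mule0// !mule1 muleC.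
  have [mW W0 _] := indW.
  have next0 w : next_gen k 0 w = eps k w by rewrite /next_gen big_ord0.
  under eq_integral do rewrite next0.
  rewrite (base k W (\int[P]_w W w)%E)//; last 2 first.
  - exact: integral_ge0.
  - move=> n; have [_ ->] := indepW_restrict mF [set n] Seps indW.
    by congr (_ * _)%E; exact: eps_id.
  congr (_ * _)%E; rewrite -[LHS]mul1e -(base 1%N (cst 1%E) 1%E)//.
    by apply: eq_integral => w _; rewrite mul1e.
  move=> n; rewrite mul1e; under eq_integral do rewrite mul1e.
  exact: (integral_nat_indic P _ (mF (IEps 1))).
have [a0 a1] := andP alpha01.
have [mW W0 _] := indW.
have Si := Sxi x (ltnSn x).
have [P1 P0] := xi_law k1 (ltn0Sn x).
have [ind1 E1] := indepW_restrict mF [set 1%N] Si indW.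
have [ind0 E0] := indepW_restrict mF [set 0%N] Si indW.
have sub j : (j < x)%N -> (S `\ IXi k x.+1) (IXi k j.+1).
  by move=> jx; split; [apply: Sxi; exact: ltnW|case=> jE; rewrite jE ltnn in jx].
have Se : (S `\ IXi k x.+1) (IEps k) by split.
have := IH (h \o succn) _ _ (fun n => h0 n.+1) ind1 Se sub.
have := IH h _ _ h0 ind0 Se sub.
rewrite E0 E1 /= [X in (_ = _ * X * _ -> _)%E]P0 [X in (_ -> _ = _ * X * _ -> _)%E]P1 => IH0 IH1.
have [mW1 W10 _] := ind1; have [mW2 W20 _] := ind0.
have mh g : measurable_fun setT (fun w => g (next_gen k x w) : \bar R).
  exact: (measurable_nat_comp g (measurable_next_gen k x)).
transitivity (\int[P]_w ((W w * (\1_[set 1%N] (xi k x.+1 w))%:E) * (h \o succn) (next_gen k x w) +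
   (W w * (\1_[set 0%N] (xi k x.+1 w))%:E) * h (next_gen k x w)))%E; last first.
  rewrite ge0_integralD//; last 4 first.
  - by move=> w _; rewrite mule_ge0//= h0.
  - by apply: emeasurable_funM => //; exact: (mh (h \o succn)).
  - by move=> w _; rewrite mule_ge0//= h0.
  - by apply: emeasurable_funM => //; exact: mh.
  have h0' n : (0 <= (h \o succn) n)%E by exact: h0.
  rewrite IH0 IH1 ge0_muleDr ?mule_ge0 ?kernel_ge0 ?lee_fin ?subr_ge0 ?(ltW a0) ?(ltW a1)//.
  by rewrite !muleA.
(* The equality is only almost sure, because the law of [xi] makes it 0 or 1 only almost surely. *)
apply: ge0_ae_eq_integral => //.
- apply: emeasurable_funM => //.
  exact: (measurable_nat_comp h (measurable_next_gen k x.+1)).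
- by apply: emeasurable_funD; apply: emeasurable_funM => //; exact: (mh (h \o succn)).
- by move=> w _; rewrite mule_ge0.
- by move=> w _; rewrite adde_ge0// mule_ge0//= h0.
apply: filterS (xi01 k1 (ltn0Sn x)) => w xiw _.
have -> : next_gen k x.+1 w = (xi k x.+1 w + next_gen k x w)%N.
  by rewrite /next_gen big_ord_recr/= addnAC addnC.
by rewrite !indicE !classical_sets.in_set1; case: xiw => ->; rewrite /= !(mule0,mule1,mul0e,adde0,add0e).
Qed.

(** Conditioning on [X n = x] without dividing by its probability, so states of probability zero
    need no separate treatment. *)
Definition at_state n x (W : T -> \bar R) w : \bar R := (W w * (X n w == x)%:R%:E)%E.

Lemma measurable_transition d' (U : measurableType d') n (g : nat -> nat -> U) :
  measurable_fun setT (fun w => g (X n w) (X n.+1 w)).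
Proof.
apply: (measurable_freeze (measurable_inarX n) (G := fun x w => g x (X n.+1 w))) => x.
exact: (measurable_nat_comp (g x) (measurable_inarX n.+1)).
Qed.

(** On [X n = x] the random number of summands is frozen, so [indepW_next_gen] applies state by
    state. The set [S] is left free because [past_atS] uses it with a finite set of later indices
    removed. *)
Lemma integral_transition n (S : set inar_idx) W (g : nat -> nat -> \bar R) :
  S (IEps n.+1) -> (forall j, S (IXi n.+1 j.+1)) ->
  measurable_fun setT W -> (forall w, (0 <= W w)%E) ->
  (forall x, indepW P (inar_family X0 eps xi) S (at_state n x W)) ->
  (forall x y, (0 <= g x y)%E) ->
  (\int[P]_w (W w * g (X n w) (X n.+1 w)) =
   \big[+%E/0]_(0 <= x <oo) (\int[P]_w at_state n x W w * kernel x (g x)))%E.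
Proof.
move=> Se Sx mW W0 indW g0.
rewrite (integral_split_nat P (measurable_inarX n)); last 2 first.
- by apply: emeasurable_funM => //; exact: measurable_transition.
- by move=> w; rewrite mule_ge0.
apply: eq_eseriesr => x _.
rewrite -(indepW_next_gen (ltn0Sn n) (g0 x) (indW x) Se (fun j _ => Sx j)).
apply: eq_integral => w _; rewrite /at_state inarXS.
by case: eqP => [->|_]; rewrite !(mule1, mule0, mul0e).
Qed.

(* The only consequence of [W] being a function of the chain up to time [n]
   that is needed. *)
Definition past_at n (W : T -> \bar R) : Prop :=
  [/\ measurable_fun setT W, (forall w, (0 <= W w)%E) &
      forall x, indepW P (inar_family X0 eps xi) (used_from n.+1) (at_state n x W)].

Lemma past_at0 : past_at 0 (cst 1%E).
Proof.
split=> // x.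
have [h _] := indepW_restrict mF [set x] (I : inar_used IX0) (indepW1 mF indF).
rewrite (_ : at_state 0 x _ =
  (fun w => cst 1%E w * (\1_[set x] (inar_family X0 eps xi IX0 w))%:E)%E).
  apply: sub_indepW h => i [Si ti]; split=> //=.
  by move=> i0; rewrite i0 in ti.
by apply/funext => w; rewrite /at_state indicE classical_sets.in_set1.
Qed.

(** A cylinder over indices of time at least [n.+2] can be absorbed into the weight, as [W'],
    without touching the variables of time [n.+1]. The transition from [n] is then integrated as
    usual, and the cylinder leaves each term as the constant factor [c]. *)
Lemma past_atS n W (f : nat -> nat -> R) : past_at n W -> (forall x y, 0 <= f x y) ->
  past_at n.+1 (fun w => W w * (f (X n w) (X n.+1 w))%:E)%E.
Proof.
move=> [mW W0 indW] f0.
have mWf : measurable_fun setT (fun w => W w * (f (X n w) (X n.+1 w))%:E)%E.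
  apply: emeasurable_funM => //.
  exact: (measurable_transition n (fun x y => (f x y)%:E)).
split=> //; first by move=> w; rewrite mule_ge0 ?lee_fin.
move=> y; split.
- apply: emeasurable_funM => //.
  exact: (measurable_nat_comp (fun z => (z == y)%:R%:E) (measurable_inarX n.+1)).
- by move=> w; rewrite !mule_ge0 ?lee_fin.
move=> J A JN JS.
pose g x z := (f x z * (z == y)%:R)%:E : \bar R.
have g0 x z : (0 <= g x z)%E by rewrite lee_fin mulr_ge0.
pose c := (\prod_(i <- J) P (inar_family X0 eps xi i @^-1` A i))%E.
have c0 : (0 <= c)%E by apply: prode_ge0.
have usedx i : [set i | List.In i J] i -> (n.+2 <= idx_time i)%N by move=> /JS [].
pose W' w := (W w * (cyl R (inar_family X0 eps xi) J A w)%:E)%E.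
have W'0 w : (0 <= W' w)%E by rewrite mule_ge0// lee_fin cyl_ge0.
have at_stateW' x :
    at_state n x W' = fun w => (at_state n x W w * (cyl R (inar_family X0 eps xi) J A w)%:E)%E.
  by apply/funext => w; rewrite /at_state/W' muleAC.
have JS1 i : List.In i J -> used_from n.+1 i by move=> /JS [? /ltnW]; split.
have indW' x : indepW P (inar_family X0 eps xi)
    (used_from n.+1 `\` [set i | List.In i J]) (at_state n x W').
  by rewrite at_stateW'; apply: (indepW_cyl mF).
have mW' : measurable_fun setT W'.
  by apply: emeasurable_funM => //; apply/measurable_EFinP; exact: measurable_cyl.
have swap V : (forall w, (V w * (f (X n w) (X n.+1 w))%:E * (X n.+1 w == y)%:R%:E =
    V w * g (X n w) (X n.+1 w))%E) by move=> w; rewrite -muleA.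
transitivity (\int[P]_w (W' w * g (X n w) (X n.+1 w)))%E.
  by apply: eq_integral => w _; rewrite /at_state swap muleAC.
rewrite (integral_transition _ _ mW' W'0 indW' g0); last 2 first.
- by split=> // /usedx /=; rewrite ltnn.
- by move=> j; split=> // /usedx /=; rewrite ltnn.
have -> : (\int[P]_w at_state n.+1 y (fun w0 : T => W w0 * (f (X n w0) (X n.+1 w0))%:E) w =
    \int[P]_w (W w * g (X n w) (X n.+1 w)))%E.
  by apply: eq_integral => w _; rewrite /at_state swap.
rewrite (integral_transition (S := used_from n.+1) _ _ mW W0 indW g0)//.
rewrite -/c muleC -nneseriesMl//; last first.
  move=> x; rewrite mule_ge0 ?kernel_ge0// integral_ge0// => w _.
  by rewrite mule_ge0 ?lee_fin.
apply: eq_eseriesr => x _; rewrite at_stateW'.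
have [_ _ ->//] := indW x.
by rewrite -muleA muleCA.
Qed.

Lemma integral_transition_le n W (g : nat -> nat -> \bar R) (h : nat -> \bar R) :
  past_at n W -> (forall x y, (0 <= g x y)%E) -> (forall x, (0 <= h x)%E) ->
  (forall x, (kernel x (g x) <= h x)%E) ->
  (\int[P]_w (W w * g (X n w) (X n.+1 w)) <= \int[P]_w (W w * h (X n w)))%E.
Proof.
move=> [mW W0 indW] g0 h0 gh.
have W_0 x w : (0 <= at_state n x W w)%E by rewrite mule_ge0 ?lee_fin.
rewrite (integral_transition (S := used_from n.+1) _ _ mW W0 indW g0)//.
rewrite (integral_split_nat P (measurable_inarX n)); last 2 first.
- by apply: emeasurable_funM => //; exact: (measurable_nat_comp h (measurable_inarX n)).
- by move=> w; rewrite mule_ge0.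
apply: lee_nneseries => [x _ _|x _].
  by rewrite mule_ge0 ?kernel_ge0// integral_ge0.
have [mWx _ _] := indW x.
apply: le_trans (lee_wpmul2l _ (gh x)) _; first by rewrite integral_ge0.
rewrite muleC -ge0_integralZl//.
apply: ge0_le_integral => //.
- by move=> w _; rewrite mule_ge0.
- by apply: emeasurable_funM.
- apply: emeasurable_funM; first apply: emeasurable_funM => //.
    exact: (measurable_nat_comp h (measurable_inarX n)).
  exact: (measurable_nat_comp (fun z => (z == x)%:R%:E) (measurable_inarX n)).
by move=> w _; rewrite /at_state; case: eqP => [->|_]; rewrite !(mule1, mule0)// muleC.
Qed.

Lemma expectation_transition_le n (g : nat -> nat -> \bar R) (h : nat -> \bar R) :
  (forall x y, (0 <= g x y)%E) -> (forall x, (0 <= h x)%E) ->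
  (forall x, (kernel x (g x) <= h x)%E) ->
  (\int[P]_w g (X n w) (X n.+1 w) <= \int[P]_w h (X n w))%E.
Proof.
move=> g0 h0 gh.
have past1 : past_at n (cst 1%E).
  elim: n => [|n IH]; first exact: past_at0.
  have := past_atS IH (f := fun _ _ => 1) (fun _ _ => ler01).
  by congr past_at; apply/funext => w; rewrite mule1.
have := integral_transition_le past1 g0 h0 gh.
by under eq_integral do rewrite mul1e; under [X in (_ <= X)%E -> _]eq_integral do rewrite mul1e.
Qed.

(** The supermartingale step: the product of the first [n] factors is itself a weight satisfying
    [past_at n], so integrating the last transition against it cannot increase its mass. *)
Lemma expectation_prod_le1 (f : nat -> nat -> R) :
  (forall x y, 0 <= f x y) -> (forall x, (kernel x (EFin \o f x) <= 1)%E) ->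
  forall n, (\int[P]_w (\prod_(k < n) f (X k w) (X k.+1 w))%:E <= 1)%E.
Proof.
move=> f0 f1 n.
have EP m : (fun w => (\prod_(k < m.+1) f (X k w) (X k.+1 w))%:E) =
    (fun w => (\prod_(k < m) f (X k w) (X k.+1 w))%:E * (f (X m w) (X m.+1 w))%:E)%E.
  by apply/funext => w; rewrite big_ord_recr EFinM.
have E0 : (fun w => (\prod_(k < 0) f (X k w) (X k.+1 w))%:E) = cst 1%E.
  by apply/funext => w; rewrite big_ord0.
have past m : past_at m (fun w => (\prod_(k < m) f (X k w) (X k.+1 w))%:E).
  by elim: m => [|m IH]; [rewrite E0; exact: past_at0|rewrite EP; exact: past_atS].
elim: n => [|n IH]; first by rewrite E0 integral_cst// mul1e probability_le1.
rewrite EP; apply: le_trans IH.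
have := integral_transition_le (h := cst 1%E) (past n) (fun x y => f0 x y : (0 <= (f x y)%:E)%E) (fun _ => lee01) f1.
by under [X in (_ <= X)%E -> _]eq_integral do rewrite mule1.
Qed.

Lemma kernel_le x h h' : (forall n, (0 <= h n)%E) -> (forall n, (h n <= h' n)%E) ->
  (kernel x h <= kernel x h')%E.
Proof.
have [a0 a1] := andP alpha01.
elim: x h h' => [|x IH] h h' h0 hh' /=.
  apply: ge0_le_integral => //.
  - exact: (measurable_nat_comp h (mF (IEps 1))).
  - exact: (measurable_nat_comp h' (mF (IEps 1))).
apply: leeD; apply: lee_wpmul2l; rewrite ?lee_fin ?subr_ge0 ?(ltW a0) ?(ltW a1)//.
- by apply: IH => n; [exact: h0|exact: hh'].
- exact: IH.
Qed.

(** * Conditional mean, variance and exponential moment of one step *)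

Variables mu m2 : R.
Hypothesis mean_eps : (\int[P]_w ((eps 1%N w)%:R)%:E = mu%:E)%E.
Hypothesis sqmean_eps : (\int[P]_w ((eps 1%N w)%:R ^+ 2)%:E = m2%:E)%E.

Let s2 := m2 - mu ^+ 2.
Definition cmean (x : R) := alpha * x + mu.
Definition cvar (x : R) := alpha * (1 - alpha) * x + s2.

(** Adding one Bernoulli variable shifts [y] by 1 with probability [alpha], turning the coefficients
    into [a + b + c], [b + 2 c], [c]; the means and variances of the summands add up along the
    induction. *)
Lemma kernel_quad x a b c : (forall y : nat, 0 <= a + b * y%:R + c * y%:R ^+ 2) ->
  kernel x (fun y => (a + b * y%:R + c * y%:R ^+ 2)%:E) =
  (a + b * cmean x%:R + c * (cmean x%:R ^+ 2 + cvar x%:R))%:E.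
Proof.
elim: x a b c => [|x IH] a b c q0 /=.
  have meps g : measurable_fun setT (fun w => g (eps 1%N w) : \bar R).
    exact: (measurable_nat_comp g (mF (IEps 1))).
  have i1 : P.-integrable setT (fun w => ((eps 1%N w)%:R)%:E).
    apply/integrableP; split; first exact: (meps (fun n => n%:R%:E)).
    under eq_integral do rewrite gee0_abs ?lee_fin//.
    by rewrite mean_eps ltry.
  have i2 : P.-integrable setT (fun w => ((eps 1%N w)%:R ^+ 2)%:E).
    apply/integrableP; split; first exact: (meps (fun n => (n%:R ^+ 2)%:E)).
    under eq_integral do rewrite gee0_abs ?lee_fin ?sqr_ge0//.
    by rewrite sqmean_eps ltry.
  have i0 : P.-integrable setT (fun w => a%:E).
    by apply: finite_measure_integrable_cst.
  under eq_integral do rewrite -addrA EFinD EFinD !EFinM.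
  rewrite integralD//; last first.
    by apply: integrableD => //; apply: integrableZl.
  rewrite integralD//; try by apply: integrableZl.
  rewrite !integralZl// mean_eps sqmean_eps integral_cst// [X in (_ * X + _)%E](probability_setT P).
  rewrite mule1 -!EFinM -!EFinD; congr EFin; rewrite /cmean /cvar /s2; ring.
have q1 (y : nat) : 0 <= (a + b + c) + (b + 2 * c) * y%:R + c * y%:R ^+ 2.
  by have := q0 y.+1; rewrite -natr1; congr (_ <= _); ring.
rewrite IH// (_ : _ \o succn = fun y => ((a + b + c) + (b + 2 * c) * y%:R + c * y%:R ^+ 2)%:E).
  rewrite IH// -!EFinM -!EFinD -natr1; congr EFin; rewrite /cmean /cvar; ring.
by apply/funext => y /=; congr EFin; rewrite -natr1; ring.
Qed.

Lemma kernel_sqr_dev x a b t : 0 <= a -> 0 <= t ->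
  kernel x (fun y => (a + t * (y%:R - b) ^+ 2)%:E) =
  (a + t * ((cmean x%:R - b) ^+ 2 + cvar x%:R))%:E.
Proof.
move=> a0 t0; have := @kernel_quad x (a + t * b ^+ 2) (- 2 * t * b) t.
rewrite (_ : (fun y => _) = (fun y => (a + t * (y%:R - b) ^+ 2)%:E)); last first.
  by apply/funext => y; congr EFin; ring.
move=> -> //; first by congr EFin; ring.
move=> y; have : 0 <= a + t * (y%:R - b) ^+ 2 by rewrite addr_ge0// mulr_ge0// sqr_ge0.
by congr (_ <= _); ring.
Qed.

Lemma s2_ge0 : 0 <= s2.
Proof.
have := @kernel_sqr_dev 0 0 mu 1 (lexx _) ler01.
have := @kernel_ge0 0 (fun y => (0 + 1 * (y%:R - mu) ^+ 2)%:E).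
move=> /[swap] ->; rewrite lee_fin /cmean /cvar.
have -> : 0 + 1 * ((alpha * 0 + mu - mu) ^+ 2 + (alpha * (1 - alpha) * 0 + s2)) = s2 by ring.
by apply=> n; rewrite lee_fin add0r mul1r sqr_ge0.
Qed.

(** Pointwise [expR (trunc_half u) <= 1 + u + 2 u^2]: by [expR_le_quad] below the cut, and since the
    left side is 1 and [u > 0] above it. The linear term has conditional mean zero, so the mean is
    at most [1 + c <= expR c]. *)
Lemma kernel_expR_le1 t x :
  (kernel x (fun y => (expR (trunc_half (t * (y%:R - cmean x%:R)) -
                             2 * t ^+ 2 * cvar x%:R))%:E) <= 1)%E.
Proof.
set c := 2 * t ^+ 2 * cvar x%:R.
have e0 : 0 < expR (- c) by exact: expR_gt0.
pose u (y : nat) := t * (y%:R - cmean x%:R).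
have pos (y : nat) : 0 <= 1 + u y + 2 * u y ^+ 2 by nra.
apply: (@le_trans _ _ (kernel x (fun y => ((1 + u y + 2 * u y ^+ 2) * expR (- c))%:E))).
  apply: kernel_le => y; first by rewrite lee_fin expR_ge0.
  rewrite lee_fin expRD ler_wpM2r ?(ltW e0)// /trunc_half -/(u y).
  by have [/expR_le_quad//|u2] := leP (u y) (1 / 2); rewrite expR0; nra.
rewrite /u; set e := expR _; set m := cmean x%:R.
have := @kernel_quad x ((1 - t * m + 2 * t ^+ 2 * m ^+ 2) * e)
  ((t - 4 * t ^+ 2 * m) * e) (2 * t ^+ 2 * e).
rewrite (_ : (fun y => _) =
  (fun y => ((1 + t * (y%:R - m) + 2 * (t * (y%:R - m)) ^+ 2) * e)%:E)); last first.
  by apply/funext => y; congr EFin; ring.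
move=> ->; last first.
  move=> y; have : 0 <= (1 + u y + 2 * u y ^+ 2) * e by rewrite mulr_ge0// ltW.
  by congr (_ <= _); rewrite /u -/m; ring.
rewrite lee_fin -/m.
have -> : (1 - t * m + 2 * t ^+ 2 * m ^+ 2) * e + (t - 4 * t ^+ 2 * m) * e * m +
  2 * t ^+ 2 * e * (m ^+ 2 + cvar x%:R) = (1 + c) * e by rewrite /c; ring.
rewrite /e expRN ler_pdivrMr ?expR_gt0// mul1r; exact: expR_ge1Dx.
Qed.

(** Real-valued counterpart of [kernel] on indicators, so that the jump estimates are plain real
    arithmetic. *)
Fixpoint trans_prob (x : nat) (S : set nat) : R :=
  match x with
  | 0 => fine (P (eps 1%N @^-1` S))
  | x'.+1 => alpha * trans_prob x' (succn @^-1` S) + (1 - alpha) * trans_prob x' S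
  end.

Lemma kernel_trans_prob x S a b : 0 <= a -> 0 <= b ->
  kernel x (fun y => (a + b * \1_S y)%:E) = (a + b * trans_prob x S)%:E.
Proof.
move=> a0 b0; elim: x S => [|x IH] S /=.
  have mS : measurable_fun setT (fun w => (\1_S (eps 1%N w) : R)%:E).
    exact: (measurable_nat_comp (fun n => (\1_S n)%:E) (mF (IEps 1))).
  under eq_integral do rewrite EFinD EFinM.
  rewrite ge0_integralD//; last 2 first.
  - by move=> w _; rewrite mule_ge0 ?lee_fin ?indicE.
  - exact: emeasurable_funM.
  rewrite ge0_integralZl_EFin//.
  rewrite (integral_nat_indic P _ (mF (IEps 1))) integral_cst//.
  rewrite [X in (_ * X + _)%E](probability_setT P) mule1 EFinD EFinM fineK//.
  by rewrite fin_num_measure//; exact: (measurable_preimage_nat S (mF (IEps 1))).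
have -> : (fun y => (a + b * \1_S y)%:E) \o succn =
    (fun y => (a + b * \1_(succn @^-1` S) y)%:E) by [].
by rewrite !IH -!EFinM -!EFinD; congr EFin; ring.
Qed.

Lemma trans_prob_ge0 x S : 0 <= trans_prob x S.
Proof.
have [a0 a1] := andP alpha01.
elim: x S => [|x IH] S /=; first by rewrite fine_ge0 ?measure_ge0.
by rewrite addr_ge0// mulr_ge0// ?subr_ge0 ?(ltW a0) ?(ltW a1).
Qed.

Lemma trans_probD_le1 x S S' : S `&` S' = set0 -> trans_prob x S + trans_prob x S' <= 1.
Proof.
have [a0 a1] := andP alpha01.
elim: x S S' => [|x IH] S S' SS' /=.
  have mS B := measurable_preimage_nat B (mF (IEps 1)).
  rewrite -lee_fin EFinD !fineK ?fin_num_measure//; try exact: (mS _).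
  rewrite -measureU//; try exact: (mS _); last by rewrite -preimage_setI SS' preimage_set0.
  by apply: probability_le1; apply: measurableU; exact: (mS _).
have := IH _ _ SS'.
have := IH (succn @^-1` S) (succn @^-1` S').
rewrite -preimage_setI SS' preimage_set0 => /(_ erefl); nra.
Qed.

(** From 0, staying means that the innovation is 0. From [x.+1], the last individual survives or
    dies, and the others must then end at [x] or at [x.+1]; these two events are disjoint, so the
    probability is at most the larger of [alpha] and [1 - alpha]. *)
Lemma trans_prob_stay (q : R) x : q <= alpha -> q <= 1 - alpha ->
  fine (P (eps 1%N @^-1` [set 0%N])) <= 1 - q -> trans_prob x [set x] <= 1 - q.
Proof.
have [a0 a1] := andP alpha01.
move=> qa qa' q0; case: x => [//|x] /=.
have -> : succn @^-1` [set x.+1] = [set x] by apply/seteqP; split=> y /= [->].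
have : trans_prob x [set x] + trans_prob x [set x.+1] <= 1.
  by apply: trans_probD_le1; apply/seteqP; split=> // y [/= ->] /n_Sn.
have := trans_prob_ge0 x [set x]; have := trans_prob_ge0 x [set x.+1]; nra.
Qed.

(** * Moments of the chain and almost sure bounds along its paths *)

Hypothesis sqmean_X0 : (\int[P]_w ((X0 w)%:R ^+ 2)%:E < +oo)%E.

(** With [z = 1 + x], the conditional second moment is [alpha^2 z^2] plus lower order terms. Raising
    the factor to the midpoint of [alpha^2] and 1 leaves room to absorb the linear term [B z] by
    completing a square, which produces the last summand of the constant. *)
Lemma kernel_sq_contract : exists2 b : R, 0 <= b & forall x,
  (kernel x (fun y => ((1 + y%:R) ^+ 2)%:E) <=
   ((1 + alpha ^+ 2) / 2 * (1 + x%:R) ^+ 2 + b)%:E)%E.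
Proof.
have [a0 a1] := andP alpha01.
have s0 := s2_ge0.
set e := 1 - alpha + mu.
set B := 2 * alpha * e + alpha * (1 - alpha).
have c0 : 0 < 1 - alpha ^+ 2 by nra.
exists (e ^+ 2 + s2 + B ^+ 2 / (2 * (1 - alpha ^+ 2))) => [|x].
  apply: addr_ge0; first by rewrite addr_ge0 ?sqr_ge0.
  by apply: divr_ge0; [exact: sqr_ge0|apply: mulr_ge0 => //; exact: ltW].
have := @kernel_sqr_dev x 0 (-1) 1 (lexx _) ler01.
rewrite (_ : (fun y => _) = (fun y => ((1 + y%:R) ^+ 2)%:E)); last first.
  by apply/funext => y; congr EFin; ring.
move=> ->; rewrite lee_fin /cmean /cvar -/e.
set z := 1 + x%:R.
have h : 0 <= ((1 - alpha ^+ 2) * z - B) ^+ 2 / (2 * (1 - alpha ^+ 2)).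
  by apply: divr_ge0; [exact: sqr_ge0|apply: mulr_ge0 => //; exact: ltW].
have hz : 0 <= alpha * (1 - alpha) by nra.
rewrite -subr_ge0; apply: le_trans (addr_ge0 h hz) _.
rewrite le_eqVlt; apply/orP; left; apply/eqP.
rewrite /B /e /z; field.
by rewrite gt_eqF.
Qed.

Lemma sq_moment_bound : exists c : R,
  forall k, (\int[P]_w ((1 + (X k w)%:R) ^+ 2)%:E <= c%:E)%E.
Proof.
have [a0 a1] := andP alpha01.
have [b b0 hb] := kernel_sq_contract.
have mX k (g : nat -> R) : measurable_fun setT (fun w => (g (X k w))%:E).
  exact: (measurable_nat_comp (fun n => (g n)%:E) (measurable_inarX k)).
have fin0 : (\int[P]_w ((1 + (X 0 w)%:R) ^+ 2)%:E < +oo)%E.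
  apply: (@le_lt_trans _ _ (\int[P]_w ((2 : R)%:E + (2 : R)%:E * ((X0 w)%:R ^+ 2)%:E))%E).
    apply: ge0_le_integral => //.
    - exact: (mX 0%N (fun n => (1 + n%:R) ^+ 2)).
    - exact: (mX 0%N (fun n => 2 + 2 * n%:R ^+ 2)).
    - by move=> w _; rewrite -EFinM -EFinD lee_fin /=; set v := _%:R; have := sqr_ge0 (v - 1); nra.
  have m0 := mX 0%N (fun n => n%:R ^+ 2).
  rewrite ge0_integralD//; last exact: (mX 0%N (fun n => 2 * n%:R ^+ 2)).
  rewrite integral_cst// [X in (_ * X + _)%E](probability_setT P) mule1.
  rewrite ge0_integralZl_EFin//.
  by rewrite lte_add_pinfty ?ltry// lte_mul_pinfty// lee_fin.
set I0 := (\int[P]_w _)%E in fin0.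
have I00 : (0 <= I0)%E by apply: integral_ge0 => w _; rewrite lee_fin sqr_ge0.
have I0E : I0 = (fine I0)%:E by rewrite fineK// ge0_fin_numE.
set r := (1 + alpha ^+ 2) / 2 in hb.
have r0 : 0 <= r by rewrite divr_ge0// addr_ge0// sqr_ge0.
have r1 : 0 < 1 - r by rewrite /r; nra.
(* [b / (1 - r)] is the fixed point of [m |-> r m + b]; adding the initial moment gives a bound that
   the recursion preserves. *)
exists (fine I0 + b / (1 - r)); elim=> [|k IH].
  by rewrite -/I0 I0E lee_fin lerDl divr_ge0// ltW.
have := expectation_transition_le k (g := fun _ y => ((1 + y%:R) ^+ 2)%:E)
  (h := fun x => (r * (1 + x%:R) ^+ 2 + b)%:E)
  (fun _ y => sqr_ge0 _ : (0 <= ((1 + y%:R) ^+ 2)%:E)%E) _ hb.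
move=> /(_ _)/le_trans; apply.
  by move=> x; rewrite lee_fin addr_ge0// mulr_ge0// sqr_ge0.
under eq_integral do rewrite EFinD EFinM.
rewrite ge0_integralD//; last 2 first.
- by move=> w _; rewrite -EFinM lee_fin mulr_ge0// sqr_ge0.
- exact: (mX k (fun n => r * (1 + n%:R) ^+ 2)).
rewrite integral_cst// [X in (_ + _ * X)%E](probability_setT P) mule1.
rewrite ge0_integralZl_EFin//; last exact: (mX k (fun n => (1 + n%:R) ^+ 2)).
apply: (@le_trans _ _ (r%:E * (fine I0 + b / (1 - r))%:E + b%:E)%E).
  by rewrite leeD2r// lee_wpmul2l// lee_fin.
rewrite -EFinM -EFinD lee_fin.
have -> : r * (fine I0 + b / (1 - r)) + b = r * fine I0 + b / (1 - r).
  by field; rewrite gt_eqF.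
rewrite lerD2r -[leRHS]mul1r; apply: ler_wpM2r; first exact: fine_ge0.
by rewrite -subr_ge0 ltW.
Qed.

(** The squared residual has conditional mean [cvar x], affine in [x]. Weighted by [1 + x] it stays
    of order [(1 + x)^2], so the uniform second moment is enough. *)
Lemma ae_sq_growth : {ae P, forall w, exists C : R, forall k,
  (1 + (X k w)%:R) ^+ 2 + (1 + (X k w)%:R) * ((X k.+1 w)%:R - cmean (X k w)%:R) ^+ 2
  <= C * rho R k ^+ 48}.
Proof.
have [a0 a1] := andP alpha01.
have s0 := s2_ge0.
have [c hc] := sq_moment_bound.
have mX k (g : nat -> R) : measurable_fun setT (fun w => (g (X k w))%:E).
  exact: (measurable_nat_comp (fun n => (g n)%:E) (measurable_inarX k)).
pose g (x y : nat) : R := (1 + x%:R) ^+ 2 + (1 + x%:R) * (y%:R - cmean x%:R) ^+ 2.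
have g0 x y : 0 <= g x y by rewrite addr_ge0 ?sqr_ge0// mulr_ge0 ?sqr_ge0// addr_ge0.
apply: (@ae_growth R _ _ P (fun k w => g (X k w) (X k.+1 w)) ((2 + s2) * c)).
- by move=> k; exact: (measurable_transition k g).
- by move=> k w; exact: g0.
move=> k.
have := expectation_transition_le k (g := fun x y => (g x y)%:E)
  (h := fun x => ((2 + s2) * (1 + x%:R) ^+ 2)%:E)
  (fun x y => g0 x y : (0 <= (g x y)%:E)%E).
move=> /(_ _ _)/le_trans; apply.
- by move=> x; rewrite lee_fin mulr_ge0 ?sqr_ge0// addr_ge0.
- move=> x; rewrite /g kernel_sqr_dev ?sqr_ge0// ?addr_ge0// lee_fin subrr /cvar.
  have x0 : 0 <= x%:R :> R by [].
  move: (x%:R) x0 => v v0; nra.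
under eq_integral do rewrite EFinM.
rewrite ge0_integralZl_EFin//; last 2 first.
- exact: (mX k (fun n => (1 + n%:R) ^+ 2)).
- by rewrite addr_ge0.
by rewrite EFinM lee_wpmul2l// lee_fin addr_ge0.
Qed.

(** By [ae_growth] the product of exponentials is at most [C * rho n ^ 48]. Taking logarithms with
    [C <= expR C] and [rho n <= expR (rho n)] is crude, but [rho n] is already a very small power of
    [n]. *)
Lemma ae_exp_bound (f : nat -> nat -> nat -> R) :
  (forall n x, (kernel x (fun y => (expR (f n x y))%:E) <= 1)%E) ->
  {ae P, forall w, exists C : R, forall n,
    \sum_(k < n) f n (X k w) (X k.+1 w) <= C + 48 * rho R n}.
Proof.
move=> f1.
have := @ae_growth R _ _ P (fun n w => \prod_(k < n) expR (f n (X k w) (X k.+1 w))) 1.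
have h1 n m : measurable_fun setT (fun w => \prod_(k < m) expR (f n (X k w) (X k.+1 w))).
  elim: m => [|m IH].
    by rewrite (_ : (fun _ => _) = cst 1)//; apply/funext => w; rewrite big_ord0.
  rewrite (_ : (fun _ => _) = (fun w => (\prod_(k < m) expR (f n (X k w) (X k.+1 w))) *
    expR (f n (X m w) (X m.+1 w)))); last by apply/funext => w; rewrite big_ord_recr.
  apply: measurable_funM => //.
  exact: (measurable_transition m (fun x y => expR (f n x y))).
have h2 n w : 0 <= \prod_(k < n) expR (f n (X k w) (X k.+1 w)).
  by apply: prodr_ge0 => k _; exact: expR_ge0.
have h3 n := expectation_prod_le1 (f := fun x y => expR (f n x y)) (fun x y => expR_ge0 _) (f1 n) n.
move=> /(_ (fun n => h1 n n) h2 h3); apply: filterS => w [C hC].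
exists C => n; have := hC n; rewrite -expR_sum => h.
rewrite -ler_expR; apply: (le_trans h).
rewrite expRD; apply: ler_pM => //.
- have := hC 0%N; rewrite big_ord0 => h0.
  rewrite leNgt; apply/negP => Cn.
  have : C * rho R 0 ^+ 48 < 0 by rewrite pmulr_llt0// exprn_gt0// rho_gt0.
  by rewrite ltNge (le_trans _ h0).
- by rewrite exprn_ge0// ltW// rho_gt0.
- by apply: le_trans (expR_ge1Dx C); rewrite lerDr.
rewrite expRM_natl lerXn2r ?nnegrE ?expR_ge0 ?(ltW (rho_gt0 _ _))//.
by apply: le_trans (expR_ge1Dx _); rewrite lerDr.
Qed.

(** The path stays with probability at most [1 - q], and [expR (-1) <= 1/2], so the mean is at most
    [expR (q/2) * (1 - q/2) <= 1]. *)
Lemma kernel_jump_le1 (q : R) x : 0 <= q -> q <= alpha -> q <= 1 - alpha ->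
  fine (P (eps 1%N @^-1` [set 0%N])) <= 1 - q ->
  (kernel x (fun y => (expR (q / 2 - (y != x)%:R))%:E) <= 1)%E.
Proof.
move=> q0 qa qa' qe.
have p1 := trans_prob_stay x qa qa' qe; have p0 := trans_prob_ge0 x [set x].
pose e := expR (q / 2); pose i := expR (- 1 : R).
have e0 : 0 < e by exact: expR_gt0.
have i0 : 0 < i by exact: expR_gt0.
have i12 : i <= 1 / 2.
  have := expR_ge1Dx (1 : R); have : expR 1 * i = 1 by rewrite -expRD subrr expR0.
  by move: (expR 1) => z; nra.
have -> : (fun y => (expR (q / 2 - (y != x)%:R))%:E) =
    (fun y => (e * i + e * (1 - i) * \1_[set x] y)%:E).
  apply/funext => y; congr EFin; rewrite indicE classical_sets.in_set1.
  by case: eqP => [_|_] /=; rewrite ?subr0 ?expRD -/e -/i; ring.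
rewrite kernel_trans_prob ?mulr_ge0 ?(ltW e0) ?(ltW i0)//; last by lra.
rewrite lee_fin; have eq1 : e * (1 - q / 2) <= 1.
  have := expR_ge1Dx (- (q / 2)); have : e * expR (- (q / 2)) = 1 by rewrite -expRD subrr expR0.
  by move: (expR (- _)) => z; nra.
apply: le_trans eq1; rewrite -mulrA -mulrDr; apply: ler_wpM2l; first exact: ltW.
by move: (trans_prob _ _) p0 p1 => z; nra.
Qed.

End Chain.

(** * Deterministic consequences along a path *)

Section Path.
Context (R : realType) (alpha mu s2 q : R) (x : nat -> R).
Hypotheses (alpha01 : 0 < alpha < 1) (mu0 : 0 <= mu) (s20 : 0 <= s2) (q0 : 0 < q).
Hypothesis x0 : forall k, 0 <= x k.
Hypothesis x_jump : forall k, x k.+1 != x k -> 1 <= (x k.+1 - x k) ^+ 2.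
Let m k := x k.+1 - (alpha * x k + mu).
Let cv k := alpha * (1 - alpha) * x k + s2.
Hypothesis sq_growth : exists C : R, forall k,
  (1 + x k) ^+ 2 + (1 + x k) * m k ^+ 2 <= C * rho R k ^+ 48.
Definition dev_bound (phi : nat -> R) := exists C : R, forall n,
  \sum_(k < n) (trunc_half (phi k / rho R n ^+ 38 * m k) -
                2 * (phi k / rho R n ^+ 38) ^+ 2 * cv k) <= C + 48 * rho R n.
Hypotheses (dev1 : dev_bound (fun=> 1)) (devN1 : dev_bound (fun=> -1))
  (devx : dev_bound x) (devNx : dev_bound (fun k => - x k)).
Hypothesis jumps : exists C : R, forall n,
  \sum_(k < n) (q / 2 - (x k.+1 != x k)%:R) <= C + 48 * rho R n.

Lemma rho_unbounded (c : R) : exists N, forall n, (N <= n)%N -> c <= rho R n.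
Proof.
pose c' := Num.max c 1.
exists (Num.bound (c' ^+ 40)) => n Nn; apply: (@le_trans _ _ c'); first by rewrite le_max lexx.
have c'0 : 0 <= c' by rewrite le_max ler01 orbT.
rewrite -(@ler_pXn2r _ 40) ?nnegrE ?(ltW (rho_gt0 _ _))// rhoX40.
apply: ltW; apply: lt_le_trans (archi_boundP _) _; first exact: exprn_ge0.
by rewrite ler_nat ltnW.
Qed.

(** Both bounds come from square roots: [((1 + x) m)^2] is [1 + x = O(rho^24)] times
    [(1 + x) m^2 = O(rho^48)], hence [O(rho^72)]. *)
Lemma x_growth : exists2 D : R, 1 <= D & forall k n, (k <= n)%N ->
  1 + x k <= D * rho R n ^+ 24 /\ (1 + x k) * `|m k| <= D ^+ 2 * rho R n ^+ 36.
Proof.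
have [C hC] := sq_growth; exists (Num.max 1 C) => [|k n kn]; first by rewrite le_max lexx.
set D := Num.max 1 C.
have D1 : 1 <= D by rewrite le_max lexx.
have CD : C <= D ^+ 2.
  by apply: (@le_trans _ _ D); [rewrite le_max lexx orbT|rewrite ler_eXnr].
have r1 : 0 <= rho R n by rewrite ltW// rho_gt0.
have D0 : 0 <= D by exact: le_trans D1.
have A0 : 0 <= 1 + x k by rewrite addr_ge0.
have h : (1 + x k) ^+ 2 + (1 + x k) * m k ^+ 2 <= D ^+ 2 * rho R n ^+ 48.
  apply: (le_trans (hC k)); apply: (@le_trans _ _ (D ^+ 2 * rho R k ^+ 48)).
    by apply: ler_wpM2r => //; rewrite exprn_ge0// ltW// rho_gt0.
  apply: ler_wpM2l; first exact: sqr_ge0.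
  by rewrite lerXn2r ?nnegrE ?(ltW (rho_gt0 _ _))// le_rho.
have A1 : 1 + x k <= D * rho R n ^+ 24.
  rewrite -(@ler_pXn2r _ 2) ?nnegrE ?mulr_ge0 ?exprn_ge0//.
  rewrite exprMn -exprM; apply: le_trans h; rewrite lerDl mulr_ge0 ?sqr_ge0//.
split=> //.
rewrite -(@ler_pXn2r _ 2) ?nnegrE ?mulr_ge0 ?exprn_ge0//.
rewrite [leRHS]exprMn -!exprM [leLHS]exprMn real_normK ?num_real// expr2 -mulrA.
apply: (@le_trans _ _ (D * rho R n ^+ 24 * (D ^+ 2 * rho R n ^+ 48))).
  apply: ler_pM => //; first by rewrite mulr_ge0 ?sqr_ge0.
  by apply: le_trans h; rewrite lerDr sqr_ge0.
rewrite (_ : _ * _ = D ^+ 3 * rho R n ^+ 72); last by ring.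
by apply: ler_wpM2r; rewrite ?exprn_ge0// ler_weXn2l.
Qed.

(** Once [rho n >= 2 D], the truncated argument is at most [D^2 / rho^2 <= 1/2] and the truncation
    is inactive. Multiplying by [rho^38] turns the error [C + 48 rho] into a multiple of [rho^39],
    that is of [n.+1 / rho]. *)
Lemma dev_sum phi D : dev_bound phi -> 1 <= D ->
  (forall k n, (k <= n)%N -> `|phi k * m k| <= D ^+ 2 * rho R n ^+ 36) ->
  exists G N, [/\ 0 <= G & forall n, (N <= n)%N ->
    \sum_(k < n) phi k * m k <=
    2 * (\sum_(k < n) phi k ^+ 2 * cv k) / rho R n ^+ 38 + G * n.+1%:R / rho R n].
Proof.
move=> [C hC] D1 phiD; exists (Num.max C 0 + 48).
have [N hN] := rho_unbounded (2 * D); exists N; split.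
  by rewrite addr_ge0// le_max lexx orbT.
move=> n Nn; have r0 := rho_gt0 R n; have r1 := rho_ge1 R n.
have D0 : 0 < D by exact: lt_le_trans D1.
have E k : (k < n)%N -> trunc_half (phi k / rho R n ^+ 38 * m k) = phi k / rho R n ^+ 38 * m k.
  move=> kn; rewrite /trunc_half ifT// mulrAC ler_pdivrMr ?exprn_gt0//.
  apply: le_trans (ler_norm _) _; apply: le_trans (phiD k n (ltnW kn)) _.
  rewrite (_ : 1 / 2 * _ = (rho R n ^+ 2 / 2) * rho R n ^+ 36); last by ring.
  apply: ler_wpM2r; first by rewrite exprn_ge0// ltW.
  have := hN n Nn; nra.
have := hC n.
rewrite sumrB (eq_bigr (fun k : 'I_n => phi k * m k / rho R n ^+ 38)); last first.
  by move=> k _; rewrite E//; ring.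
have -> : \sum_(k < n) 2 * (phi k / rho R n ^+ 38) ^+ 2 * cv k =
    2 * (\sum_(k < n) phi k ^+ 2 * cv k) / rho R n ^+ 76.
  rewrite mulr_sumr mulr_suml; apply: eq_bigr => k _; field.
  by rewrite gt_eqF.
rewrite -mulr_suml lerBlDr.
rewrite -(ler_pM2r (exprn_gt0 38 r0)) mulfVK ?gt_eqF ?exprn_gt0// => /le_trans; apply.
rewrite mulrDl addrC; apply: lerD.
  by rewrite le_eqVlt; apply/orP; left; apply/eqP; field; rewrite gt_eqF.
rewrite -(rhoX40 R n) [leRHS](_ : _ = (Num.max C 0 + 48) * rho R n * rho R n ^+ 38); last first.
  by field; rewrite gt_eqF.
apply: ler_wpM2r; first by rewrite exprn_ge0// ltW.
rewrite [leRHS]mulrDl lerD2r; apply: (@le_trans _ _ (Num.max C 0)); first by rewrite le_max lexx.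
by rewrite ler_peMr// le_max lexx orbT.
Qed.

Let S1 n := \sum_(k < n) x k.
Let S2 n := \sum_(k < n) x k ^+ 2.

Lemma dev_bounds : exists G N, [/\ 0 <= G & forall n, (N <= n)%N ->
  `|\sum_(k < n) m k| <= G / rho R n * (n.+1%:R + S1 n) /\
  `|\sum_(k < n) x k * m k| <= G / rho R n * (n.+1%:R + S2 n)].
Proof.
have [a0 a1] := andP alpha01.
have [D D1 hD] := x_growth.
have D0 : 0 <= D by exact: le_trans D1.
have mle k n : (k <= n)%N -> `|m k| <= D ^+ 2 * rho R n ^+ 36.
  move=> kn; have [_] := hD k n kn; apply: le_trans.
  by rewrite ler_peMl// lerDl.
have xmle k n : (k <= n)%N -> `|x k * m k| <= D ^+ 2 * rho R n ^+ 36.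
  move=> kn; have [_] := hD k n kn; apply: le_trans.
  by rewrite normrM (ger0_norm (x0 k)) ler_wpM2r// lerDr.
have [G1 [N1 [G10 h1]]] := dev_sum dev1 D1 (fun k n kn => (ltac:(rewrite mul1r; exact: mle kn))).
have [G2 [N2 [G20 h2]]] := dev_sum devN1 D1 (fun k n kn => (ltac:(rewrite mulN1r normrN; exact: mle kn))).
have [G3 [N3 [G30 h3]]] := dev_sum devx D1 xmle.
have [G4 [N4 [G40 h4]]] := dev_sum devNx D1 (fun k n kn => (ltac:(rewrite mulNr normrN; exact: xmle kn))).
pose B := 1 + s2.
have B0 : 0 <= B by rewrite addr_ge0.
have aa0 : 0 <= alpha * (1 - alpha) by nra.
have aa1 : alpha * (1 - alpha) <= 1 by nra.
have cvB k : cv k <= B * (1 + x k).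
  have hx := ler_piMl (x0 k) aa1; have hs := mulr_ge0 s20 (x0 k).
  by rewrite /cv /B; lra.
have cv0 k : 0 <= cv k by rewrite /cv addr_ge0// mulr_ge0.
pose G := 2 * B * D + G1 + G2 + G3 + G4.
exists G, (maxn (maxn N1 N2) (maxn N3 N4)); split.
  by rewrite /G !addr_ge0// !mulr_ge0.
move=> n; rewrite !geq_max => /andP[/andP[n1 n2] /andP[n3 n4]].
have r0 := rho_gt0 R n; have r1 := rho_ge1 R n.
have S10 : 0 <= S1 n by apply: sumr_ge0.
have S20 : 0 <= S2 n by apply: sumr_ge0 => k _; exact: sqr_ge0.
have n0 : 0 <= n.+1%:R :> R by [].
have invr_le k : (rho R n ^+ k.+1)^-1 <= (rho R n)^-1.
  by rewrite lef_pV2 ?posrE ?exprn_gt0// exprS ler_peMr ?(ltW r0)// exprn_ege1.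
have bnd1 Gi V S : 0 <= Gi -> Gi <= G - 2 * B * D -> 0 <= S -> V <= B * D * (n.+1%:R + S) ->
    2 * V / rho R n + Gi * n.+1%:R / rho R n <= G / rho R n * (n.+1%:R + S).
  move=> Gi0 GiG S0 VS; rewrite -mulrDl mulrAC; apply: ler_wpM2r; first by rewrite invr_ge0 ltW.
  have : Gi * n.+1%:R <= (G - 2 * B * D) * (n.+1%:R + S).
    apply: ler_pM => //; by rewrite lerDl.
  move: (n.+1%:R) VS => nn; nra.
have G1G : G1 <= G - 2 * B * D by rewrite /G; lra.
have G2G : G2 <= G - 2 * B * D by rewrite /G; lra.
have G3G : G3 <= G - 2 * B * D by rewrite /G; lra.
have G4G : G4 <= G - 2 * B * D by rewrite /G; lra.
have V1 : \sum_(k < n) 1 ^+ 2 * cv k <= B * D * (n.+1%:R + S1 n).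
  apply: (@le_trans _ _ (\sum_(k < n) B * (1 + x k))).
    by apply: ler_sum => k _; rewrite expr1n mul1r.
  rewrite -mulr_sumr big_split/= sumr_const card_ord -/(S1 n) -mulrA; apply: ler_wpM2l => //.
  rewrite -[leLHS]mul1r; apply: ler_pM => //; first by rewrite addr_ge0.
  by rewrite lerD2r ler_nat.
have V1' : \sum_(k < n) (-1) ^+ 2 * cv k <= B * D * (n.+1%:R + S1 n).
  by apply: le_trans V1; rewrite (eq_bigr (fun k : 'I_n => 1 ^+ 2 * cv k))// => k _; rewrite sqrrN.
(* The summand is cubic in [x k]. One factor is traded for [cv k <= B (1 + x k) <= B D rho^24],
   absorbed by [rho^37]; the one power of [rho] left from [rho^38] makes the error negligible. *)
have V2 : (\sum_(k < n) x k ^+ 2 * cv k) / rho R n ^+ 37 <= B * D * (n.+1%:R + S2 n).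
  rewrite mulr_suml; apply: (@le_trans _ _ (\sum_(k < n) B * D * x k ^+ 2)).
    apply: ler_sum => k _; rewrite mulrAC [leRHS]mulrC -mulrA; apply: ler_wpM2l; first exact: sqr_ge0.
    rewrite mulrC ler_pdivrMr ?exprn_gt0//; apply: (le_trans (cvB k)).
    rewrite -mulrA; apply: ler_wpM2l => //.
    have [h _] := hD k n (ltnW (ltn_ord k)); apply: (le_trans h); apply: ler_wpM2l => //.
    by rewrite ler_weXn2l.
  by rewrite -mulr_sumr ler_wpM2l ?mulr_ge0// lerDr.
have tail V : 0 <= V -> 2 * V / rho R n ^+ 38 <= 2 * V / rho R n.
  by move=> V0; apply: ler_wpM2l; rewrite ?mulr_ge0.
have pos phi : 0 <= \sum_(k < n) phi k ^+ 2 * cv k.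
  by apply: sumr_ge0 => k _; rewrite mulr_ge0 ?sqr_ge0.
split; rewrite ler_norml; apply/andP; split.
- rewrite lerNl -sumrN (eq_bigr (fun k : 'I_n => -1 * m k)); last by move=> k _; rewrite mulN1r.
  apply: le_trans (h2 n n2) _; apply: le_trans (lerD (tail _ (pos _)) (lexx _)) _.
  exact: bnd1.
- rewrite (eq_bigr (fun k : 'I_n => 1 * m k)); last by move=> k _; rewrite mul1r.
  apply: le_trans (h1 n n1) _; apply: le_trans (lerD (tail _ (pos _)) (lexx _)) _.
  exact: bnd1.
- rewrite lerNl -sumrN (eq_bigr (fun k : 'I_n => - x k * m k)); last by move=> k _; rewrite mulNr.
  apply: le_trans (h4 n n4) _.
  rewrite (eq_bigr (fun k : 'I_n => x k ^+ 2 * cv k)); last by move=> k _; rewrite sqrrN.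
  have -> : forall V : R, 2 * V / rho R n ^+ 38 = 2 * (V / rho R n ^+ 37) / rho R n.
    by move=> V; field; rewrite gt_eqF.
  exact: bnd1.
- apply: le_trans (h3 n n3) _.
  have -> : forall V : R, 2 * V / rho R n ^+ 38 = 2 * (V / rho R n ^+ 37) / rho R n.
    by move=> V; field; rewrite gt_eqF.
  exact: bnd1.
Qed.

Lemma inv_rho_small (c delta : R) : 0 < delta ->
  exists N, forall n, (N <= n)%N -> c / rho R n <= delta.
Proof.
move=> d0; have [N hN] := rho_unbounded (c / delta); exists N => n /hN.
by rewrite !ler_pdivrMr ?rho_gt0// mulrC.
Qed.

(** The residuals telescope to [(1 - alpha) S1 n + x n - x 0 - mu n]. For large [n] their sum is at
    most [(1 - alpha)/2 * (n.+1 + S1 n)], and the [S1 n] on the right is absorbed by half of the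
    left side. *)
Lemma S1_linear : exists K N, 0 <= K /\ forall n, (N <= n)%N -> S1 n <= K * n.+1%:R.
Proof.
have [a0 a1] := andP alpha01.
have [G [N [G0 hG]]] := dev_bounds.
have [N' hN'] := @inv_rho_small G ((1 - alpha) / 2) ltac:(lra).
exists (2 * (mu + x 0 + 1) / (1 - alpha)), (maxn N N'); split.
  by rewrite divr_ge0 ?subr_ge0 ?(ltW a1)// mulr_ge0// !addr_ge0.
move=> n; rewrite geq_max => /andP[Nn N'n].
have [hm _] := hG n Nn.
have S10 : 0 <= S1 n by apply: sumr_ge0.
have n1 : 1 <= n.+1%:R :> R by rewrite ler1n.
have Em : \sum_(k < n) m k = (1 - alpha) * S1 n + x n - x 0 - mu * n%:R.
  elim: n {Nn N'n hm S10 n1} => [|n IH]; first by rewrite /S1 !big_ord0; ring.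
  by rewrite /S1 !big_ord_recr/= IH /m /S1 -natr1; ring.
have hyp : (1 - alpha) * S1 n + x n - x 0 - mu * n%:R <= (1 - alpha) / 2 * (n.+1%:R + S1 n).
  rewrite -Em; apply: le_trans (ler_norm _) _; apply: (le_trans hm).
  by apply: ler_wpM2r; [rewrite addr_ge0|exact: hN'].
rewrite mulrAC ler_pdivlMr ?subr_gt0//.
have nn : n%:R <= n.+1%:R :> R by rewrite ler_nat.
have := x0 n; have h1 := ler_wpM2l mu0 nn; have h2 := ler_peMr (x0 0) n1.
have h3 : 0 <= alpha * n.+1%:R by rewrite mulr_ge0// ltW.
move: (n.+1%:R) n1 nn h1 h2 hyp h3 => t *; lra.
Qed.

(** * Passage to the retained indices: only finitely many are excluded *)

Variables (w : pred nat) (L : nat).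
Hypothesis wL : forall k, (L <= k)%N -> w k.

Lemma sum_notw (f : nat -> R) : (forall k, 0 <= f k) ->
  exists2 c : R, 0 <= c & forall n, \sum_(k < n | ~~ w k) f k <= c.
Proof.
move=> f0; exists (\sum_(k < L | ~~ w k) f k); first by apply: sumr_ge0.
elim=> [|n IH]; first by rewrite big_ord0 sumr_ge0.
have [nL|Ln] := ltnP n L.
  have -> : \sum_(k < L | ~~ w k) f k =
      \sum_(k < n.+1 | ~~ w k) f k + \sum_(n.+1 <= k < L | ~~ w k) f k.
    by rewrite -!(big_mkord (fun k => ~~ w k) f) -big_cat_nat.
  by rewrite lerDl sumr_ge0.
by rewrite big_mkcond big_ord_recr/= -big_mkcond/= (wL Ln) addr0.
Qed.

Lemma sum_w_dist (f : nat -> R) : exists2 c : R, 0 <= c & forall n,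
  `|\sum_(k < n) f k - \sum_(k < n | w k) f k| <= c.
Proof.
have [c c0 hc] := sum_notw (fun k => normr_ge0 (f k)); exists c => // n.
rewrite (bigID (fun k : 'I_n => w k))/= addrAC subrr add0r.
exact: le_trans (ler_norm_sum _ _ _) (hc n).
Qed.

Lemma sum_w_le (f : nat -> R) n : (forall k, 0 <= f k) ->
  \sum_(k < n | w k) f k <= \sum_(k < n) f k.
Proof.
by move=> f0; rewrite [leRHS](bigID (fun k : 'I_n => w k))/= lerDl sumr_ge0.
Qed.

Lemma nat_large (c delta : R) : 0 < delta ->
  exists N, forall n, (N <= n)%N -> c <= delta * n%:R.
Proof.
move=> d0; exists (Num.bound `|c / delta|) => n Nn.
rewrite mulrC -ler_pdivrMr//; apply: (le_trans (ler_norm _)).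
by apply: ltW; apply: lt_le_trans (archi_boundP (normr_ge0 _)) _; rewrite ler_nat.
Qed.

Lemma dev_w_small (delta : R) : 0 < delta -> exists N, forall n, (N <= n)%N ->
  `|\sum_(k < n | w k) m k| <= delta * n%:R /\
  `|\sum_(k < n | w k) x k * m k| <= delta * (n%:R + \sum_(k < n | w k) x k ^+ 2).
Proof.
move=> d0.
have [G [N [G0 hG]]] := dev_bounds.
have [K [N1 [K0 hK]]] := S1_linear.
have [c1 c10 hc1] := sum_w_dist m.
have [c2 c20 hc2] := sum_w_dist (fun k => x k * m k).
have [c3 c30 hc3] := sum_w_dist (fun k => x k ^+ 2).
have [N2 hN2] := @inv_rho_small (G * (1 + K)) (delta / 4) ltac:(lra).
have [N3 hN3] := @inv_rho_small G (delta / 4) ltac:(lra).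
have [N4 hN4] := @nat_large (c1 + c2 + (delta / 4) * c3) (delta / 2) ltac:(lra).
exists (maxn (maxn N (maxn N1 N2)) (maxn (maxn N3 N4) 1)) => n.
rewrite !geq_max => /andP[/andP[Nn /andP[n1 n2]] /andP[/andP[n3 n4] n5]].
have [hm hxm] := hG n Nn.
have r0 := rho_gt0 R n.
have nn : n.+1%:R <= 2 * n%:R :> R.
  by rewrite -(natrM _ 2 n) ler_nat mul2n -addnn -addn1 leq_add2l.
have np : 0 <= n.+1%:R :> R := ler0n R n.+1.
have hh2 := hN2 n n2; have hh3 := hN3 n n3; have hh4 := hN4 n n4.
have dn : delta / 4 * n.+1%:R <= delta / 4 * (2 * n%:R) by apply: ler_wpM2l nn; rewrite divr_ge0// ltW.
have dc : 0 <= delta / 4 * c3 by rewrite mulr_ge0// divr_ge0// ltW.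
have S20 : 0 <= S2 n by apply: sumr_ge0 => k _; exact: sqr_ge0.
split.
- have hA : `|\sum_(k < n) m k| <= delta / 4 * n.+1%:R.
    apply: (le_trans hm); apply: (@le_trans _ _ (G / rho R n * ((1 + K) * n.+1%:R))).
      apply: ler_wpM2l; first by rewrite divr_ge0// ltW.
      by rewrite mulrDl mul1r lerD2l hK.
    by rewrite mulrA; apply: ler_wpM2r => //; rewrite mulrAC.
  have := hc1 n; rewrite distrC => hd.
  have := ler_normD (\sum_(k < n | w k) m k - \sum_(k < n) m k) (\sum_(k < n) m k).
  by rewrite subrK; lra.
- have hA : `|\sum_(k < n) x k * m k| <= delta / 4 * (n.+1%:R + S2 n).
    by apply: (le_trans hxm); apply: ler_wpM2r => //; rewrite addr_ge0.
  have := hc2 n; rewrite distrC => hd.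
  have := hc3 n; rewrite -/(S2 n) ler_norml => /andP[_ hS].
  have := ler_normD (\sum_(k < n | w k) (x k * m k) - \sum_(k < n) (x k * m k)) (\sum_(k < n) (x k * m k)).
  have hS' : delta / 4 * S2 n <= delta / 4 * (c3 + \sum_(k < n | w k) x k ^+ 2).
    by apply: ler_wpM2l; [lra|lra].
  have W0 : 0 <= \sum_(k < n | w k) x k ^+ 2 by apply: sumr_ge0 => k _; exact: sqr_ge0.
  have dW := mulr_ge0 (ltW d0) W0.
  by rewrite subrK; lra.
Qed.

Lemma sum_w_x_linear : exists K N, 0 <= K /\ forall n, (N <= n)%N ->
  \sum_(k < n | w k) x k <= K * n%:R.
Proof.
have [K [N [K0 hK]]] := S1_linear; exists (2 * K), N.+1; split; first by rewrite mulr_ge0.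
move=> n Nn; apply: le_trans (sum_w_le _ x0) _; apply: (le_trans (hK n (ltnW Nn))).
rewrite [2 * K]mulrC -mulrA; apply: ler_wpM2l => //.
by rewrite -(natrM _ 2 n) ler_nat mul2n -addnn -addn1 leq_add2l; exact: leq_ltn_trans (leq0n _) Nn.
Qed.

(* A jump of the integer-valued path forces one of the two consecutive values
   to be at distance at least 1/2 from [c]. *)
Lemma sum_w_spread : exists v N, 0 < v /\ forall n c, (N <= n)%N ->
  v * n%:R <= \sum_(k < n | w k) (x k - c) ^+ 2.
Proof.
have [C hC] := jumps.
have [cL cL0 hcL] := sum_notw (fun=> ler01 : 0 <= (1 : R)).
pose C' := Num.max C 0.
have C'0 : 0 <= C' by rewrite le_max lexx orbT.
have CC' : C <= C' by rewrite le_max lexx.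
(* Since [rho^2 <= n.+1], this makes all the error terms together at most [q/4 * n.+1]. Of the
   [q/2 * n.+1] expected jumps a half remains, and the factor 4 in [sumJ] leaves [q/16]. *)
have [N hN] := rho_unbounded (4 * (q / 2 + C' + 2 * cL + 48) / q).
exists (q / 16), N.+1; split; first by rewrite divr_gt0.
case=> // n c; rewrite ltnS => Nn.
have r0 := rho_gt0 R n; have r1 := rho_ge1 R n.
pose h k := (w k)%:R * (x k - c) ^+ 2.
have h0 k : 0 <= h k by rewrite mulr_ge0 ?sqr_ge0.
have -> : \sum_(k < n.+1 | w k) (x k - c) ^+ 2 = \sum_(k < n.+1) h k.
  by rewrite big_mkcond; apply: eq_bigr => k _; rewrite /h; case: (w k); rewrite ?mul1r ?mul0r.
pose J (k : nat) : R := (x k.+1 != x k)%:R.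
(* If either endpoint of a jump is excluded, the left side is at most 0; otherwise
   [1 <= (x k.+1 - x k)^2] is at most twice the sum of the squared distances to [c]. *)
have step k : J k - (~~ w k)%:R - (~~ w k.+1)%:R <= 2 * (h k + h k.+1).
  rewrite /J /h; have := @x_jump k; case: eqP => [_ _|_ /(_ isT) xj] /=.
    apply: (@le_trans _ _ 0); last by rewrite mulr_ge0// addr_ge0// h0.
    by rewrite sub0r -opprD oppr_le0 addr_ge0.
  have s1 := sqr_ge0 (x k - c); have s3 := sqr_ge0 (x k.+1 - c).
  have sj : (x k.+1 - x k) ^+ 2 <= 2 * ((x k - c) ^+ 2 + (x k.+1 - c) ^+ 2).
    by have := sqr_ge0 (x k.+1 - c + (x k - c)); nra.
  by case: (w k); case: (w k.+1) => /=; lra.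
have notw p : \sum_(k < p) (~~ w k)%:R <= cL.
  by rewrite (eq_bigr (fun k : 'I_p => if ~~ w k then 1 else 0)) ?big_mkcond -?big_mkcond ?hcL// => k _; case: (w k).
have sumJ : \sum_(k < n) J k - 2 * cL <= 4 * \sum_(k < n.+1) h k.
  have := @ler_sum _ _ (index_enum 'I_n) xpredT _ _ (fun (k : 'I_n) _ => step k).
  rewrite !sumrB -mulr_sumr big_split/=.
  have e1 : \sum_(k < n) h k <= \sum_(k < n.+1) h k by rewrite big_ord_recr/= lerDl.
  have e2 : \sum_(k < n) h k.+1 <= \sum_(k < n.+1) h k by rewrite [leRHS]big_ord_recl/= lerDr.
  have e3 : \sum_(k < n) (~~ w k.+1)%:R <= cL :> R.
    by apply: le_trans (notw n.+1); rewrite [leRHS]big_ord_recl/= lerDr.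
  by have := notw n; lra.
have := hC n; rewrite sumrB sumr_const card_ord -/(J _) -[_ *+ n]mulr_natr => hJ.
have := hN n Nn; rewrite ler_pdivrMr// => hr.
have n1 : n.+1%:R = n%:R + 1 :> R by rewrite -natr1.
have : q * (rho R n * rho R n) <= q * n.+1%:R.
  by apply: ler_wpM2l; [exact: ltW|rewrite -(rhoX40 R n) -expr2 ler_weXn2l].
have : 4 * (q / 2 + C' + 2 * cL + 48) * rho R n <= rho R n * q * rho R n by apply: ler_wpM2r => //; exact: ltW.
have : (q / 2 + C' + 2 * cL) <= (q / 2 + C' + 2 * cL) * rho R n.
  by rewrite ler_peMr// !addr_ge0 ?mulr_ge0// ?divr_ge0// ltW.
move: hJ sumJ; rewrite /J n1.
set SJ := \sum_(i < n) _; set SH := \sum_(i < n.+1) _.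
move: (n%:R) (rho R n) r0 r1 hr => t r *.
lra.
Qed.

Lemma count_w_linear : exists N, forall n, (N <= n)%N ->
  n%:R <= 2 * \sum_(k < n | w k) 1 :> R.
Proof.
have [c c0 hc] := sum_w_dist (fun=> 1).
have [N hN] := @nat_large (2 * c) 1 ltr01; exists N => n /hN; have := hc n.
by rewrite sumr_const card_ord ler_norml => /andP[_]; lra.
Qed.
End Path.

(** * Least squares with outlier terms *)

Definition outlier_loss (R : realType) (y1 y2 y3 a m t : R) : R :=
  (y2 - a * y1 - m - t) ^+ 2 + (y3 - a * y2 - m + a * t) ^+ 2.

(** The minimizer of [outlier_loss] in [t] for fixed [a] and [m]. *)
Definition outlier_fit (R : realType) (y1 y2 y3 a m : R) : R :=
  (y2 - a * y1 - m - a * (y3 - a * y2 - m)) / (1 + a ^+ 2).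

Section OutlierLoss.
Context (R : realType) (y1 y2 y3 : R).

Lemma sqr1D_gt0 (a : R) : 0 < 1 + a ^+ 2.
Proof. by rewrite ltr_pwDl// sqr_ge0. Qed.

Lemma outlier_loss_ge0 (a m t : R) : 0 <= outlier_loss y1 y2 y3 a m t.
Proof. by rewrite addr_ge0// sqr_ge0. Qed.

Lemma outlier_lossE (a m t : R) : outlier_loss y1 y2 y3 a m t =
  outlier_loss y1 y2 y3 a m (outlier_fit y1 y2 y3 a m) +
  (1 + a ^+ 2) * (t - outlier_fit y1 y2 y3 a m) ^+ 2.
Proof.
by rewrite /outlier_loss /outlier_fit; field; rewrite gt_eqF// sqr1D_gt0.
Qed.

Lemma outlier_loss0_bound (A M : R) : exists2 C : R, 0 <= C & forall a m,
  `|a| <= A -> `|m| <= M -> outlier_loss y1 y2 y3 a m 0 <= C.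
Proof.
exists ((`|y2| + A * `|y1| + M) ^+ 2 + (`|y3| + A * `|y2| + M) ^+ 2) => [|a m aA mM].
  by rewrite addr_ge0// sqr_ge0.
have h (u v : R) : (u - a * v - m) ^+ 2 <= (`|u| + A * `|v| + M) ^+ 2.
  have le1 : `|u - a * v - m| <= `|u| + A * `|v| + M.
    apply: le_trans (ler_normB _ _) _; apply: lerD => //.
    apply: le_trans (ler_normB _ _) _; apply: lerD => //.
    by rewrite normrM ler_wpM2r.
  rewrite -[leLHS]real_normK ?num_real// lerXn2r ?nnegrE//.
  exact: le_trans le1.
by rewrite /outlier_loss mulr0 addr0 subr0; apply: lerD; exact: h.
Qed.

(* The loss is not convex because of the product [a * t], but its midpoint
   convexity defect is controlled by the increments of [a] and [m] alone. *)
Lemma outlier_loss_midpoint (A M : R) : exists2 C : R, 0 <= C &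
  forall a m t a' m' t', `|a| <= A -> `|m| <= M -> `|t| <= M ->
    `|a'| <= A -> `|m'| <= M -> `|t'| <= M ->
  2 * outlier_loss y1 y2 y3 ((a + a') / 2) ((m + m') / 2) ((t + t') / 2) +
    ((a - a') / 2 * y1 + (m - m') / 2 + (t - t') / 2) ^+ 2 <=
  outlier_loss y1 y2 y3 a m t + outlier_loss y1 y2 y3 a' m' t' +
    C * (((a - a') / 2) ^+ 2 + ((m - m') / 2) ^+ 2).
Proof.
pose c := `|y3| + A * `|y2| + M + A * M.
exists (2 * y1 ^+ 2 + 2 + 8 * c ^+ 2) => [|a m t a' m' t' aA mM tM aA' mM' tM'].
  by rewrite !addr_ge0// mulr_ge0// sqr_ge0.
have mid (B u v : R) : `|u| <= B -> `|v| <= B -> `|(u + v) / 2| <= B.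
  rewrite !ler_norml => /andP[? ?] /andP[? ?]; apply/andP; split; lra.
have ba := mid _ _ _ aA aA'; have bm := mid _ _ _ mM mM'; have bt := mid _ _ _ tM tM'.
set p := (a - a') / 2; set r := (m - m') / 2; set s := (t - t') / 2.
set ab := (a + a') / 2 in ba *; set mb := (m + m') / 2 in bm *; set tb := (t + t') / 2 in bt *.
pose L0 := y3 - ab * y2 - mb + ab * tb.
have L0c : L0 ^+ 2 <= c ^+ 2.
  have le1 : `|L0| <= c.
    rewrite /L0 /c; apply: le_trans (ler_normD _ _) _; apply: lerD; last first.
      by rewrite normrM ler_pM.
    apply: le_trans (ler_normB _ _) _; apply: lerD => //.
    apply: le_trans (ler_normB _ _) _; apply: lerD => //.
    by rewrite normrM ler_wpM2r.
  by rewrite -[leLHS]real_normK ?num_real// lerXn2r ?nnegrE//; exact: le_trans le1.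
have -> : a = ab + p by rewrite /ab /p; field.
have -> : a' = ab - p by rewrite /ab /p; field.
have -> : m = mb + r by rewrite /mb /r; field.
have -> : m' = mb - r by rewrite /mb /r; field.
have -> : t = tb + s by rewrite /tb /s; field.
have -> : t' = tb - s by rewrite /tb /s; field.
pose L1 := - p * y2 - r + ab * s + p * tb.
pose D := p * y1 + r + s.
(* The only term of indefinite sign is [4 * L0 * (p * s)]. It costs [s^2 / 2], and writing
   [s = D - p * y1 - r] charges this to one of the two copies of [D^2]; the other is kept, since it
   later forces [s = 0]. *)
have eqD : outlier_loss y1 y2 y3 (ab + p) (mb + r) (tb + s) +
  outlier_loss y1 y2 y3 (ab - p) (mb - r) (tb - s) - 2 * outlier_loss y1 y2 y3 ab mb tb =
  2 * D ^+ 2 + 2 * L1 ^+ 2 + 4 * L0 * (p * s) + 2 * (p * s) ^+ 2.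
  by rewrite /outlier_loss /D /L1 /L0; ring.
have s_le : s ^+ 2 <= 2 * D ^+ 2 + 4 * (p * y1) ^+ 2 + 4 * r ^+ 2.
  have -> : s = D - p * y1 - r by rewrite /D; ring.
  have := sqr_ge0 (D + (p * y1 + r)); have := sqr_ge0 (p * y1 - r); nra.
have cross : - (4 * L0 * (p * s)) <= 8 * c ^+ 2 * p ^+ 2 + s ^+ 2 / 2.
  have h1 := sqr_ge0 (4 * L0 * p + s).
  have h2 : L0 ^+ 2 * p ^+ 2 <= c ^+ 2 * p ^+ 2 by rewrite ler_wpM2r// sqr_ge0.
  by nra.
have n1 := sqr_ge0 L1; have n2 := sqr_ge0 (p * s).
have n3 : 0 <= y1 ^+ 2 * r ^+ 2 by rewrite mulr_ge0// sqr_ge0.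
have n4 : 0 <= c ^+ 2 * r ^+ 2 by rewrite mulr_ge0// sqr_ge0.
have n5 := sqr_ge0 p.
move: eqD; set Q1 := outlier_loss _ _ _ (ab + p) _ _; set Q2 := outlier_loss _ _ _ (ab - p) _ _.
set Q3 := outlier_loss _ _ _ ab _ _ => eqD.
rewrite -/D.
have -> : (2 * y1 ^+ 2 + 2 + 8 * c ^+ 2) * (p ^+ 2 + r ^+ 2) =
  2 * (p * y1) ^+ 2 + 2 * p ^+ 2 + 8 * (c ^+ 2 * p ^+ 2) + 2 * (y1 ^+ 2 * r ^+ 2) + 2 * r ^+ 2 + 8 * (c ^+ 2 * r ^+ 2).
  by ring.
lra.
Qed.
End OutlierLoss.

Ltac clear_ineqs := repeat match goal with H : is_true _ |- _ => clear H end.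

(** * Consistency of a regression perturbed by two outlier terms *)

Section Regression.
Context (R : realType) (alpha mu : R) (x : nat -> R) (w : pred nat).
Let m k := x k.+1 - (alpha * x k + mu).
Let S0 n : R := \sum_(k < n | w k) 1.
Let Sx n := \sum_(k < n | w k) x k.
Let Sxx n := \sum_(k < n | w k) x k ^+ 2.
Let Sm n := \sum_(k < n | w k) m k.
Let Sxm n := \sum_(k < n | w k) x k * m k.
Let Smm n := \sum_(k < n | w k) m k ^+ 2.
Hypothesis x0 : forall k, 0 <= x k.
Hypothesis dev_small : forall delta, 0 < delta -> exists N, forall n, (N <= n)%N ->
  `|Sm n| <= delta * n%:R /\ `|Sxm n| <= delta * (n%:R + Sxx n).
Hypothesis Sx_linear : exists K N, 0 <= K /\ forall n, (N <= n)%N -> Sx n <= K * n%:R.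
Hypothesis spread : exists v N, 0 < v /\ forall n c, (N <= n)%N ->
  v * n%:R <= \sum_(k < n | w k) (x k - c) ^+ 2.
Hypothesis S0_linear : exists N, forall n, (N <= n)%N -> n%:R <= 2 * S0 n.
Variables (y11 y12 y13 y21 y22 y23 : R).

Definition lsq_loss n (p : par4 R) : R :=
  \sum_(k < n | w k) (x k.+1 - p.1.1.1 * x k - p.1.1.2) ^+ 2 +
  outlier_loss y11 y12 y13 p.1.1.1 p.1.1.2 p.1.2 +
  outlier_loss y21 y22 y23 p.1.1.1 p.1.1.2 p.2.

Lemma rssE n (u v : R) :
  \sum_(k < n | w k) (x k.+1 - (alpha + u) * x k - (mu + v)) ^+ 2 =
  Smm n - 2 * u * Sxm n - 2 * v * Sm n + u ^+ 2 * Sxx n + 2 * u * v * Sx n + v ^+ 2 * S0 n.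
Proof.
rewrite /Smm /Sxm /Sm /Sxx /Sx /S0 !mulr_sumr -!sumrB -!big_split/=.
by apply: eq_bigr => k _; rewrite /m; ring.
Qed.

Let xbar n := Sx n / S0 n.
Let V n := Sxx n - xbar n * Sx n.

(** [V n] is the sum of squares centred at [xbar n], so [spread] with [c = xbar n] bounds it below.
    As [xbar n * Sx n] is [O(n)], both [n] and [Sxx n] are dominated by multiples of [V n]. *)
Lemma design : exists K v N, [/\ 0 <= K, 0 < v & forall n, (N <= n)%N ->
  [/\ 1 <= n%:R :> R, n%:R <= 2 * S0 n, S0 n != 0, 0 <= xbar n <= 2 * K &
      v * n%:R <= V n /\ Sxx n <= V n + 2 * K * K * n%:R]].
Proof.
have [K [N1 [K0 hK]]] := Sx_linear.
have [v [N2 [v0 hv]]] := spread.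
have [N3 h3] := S0_linear.
exists K, v, (maxn 1 (maxn N1 (maxn N2 N3))); split=> // n.
rewrite !geq_max => /andP[n0 /andP[n1 /andP[n2 n3]]].
have nge1 : 1 <= n%:R :> R by rewrite ler1n.
have S0n := h3 n n3.
have S0p : 0 < S0 n by lra.
have Sx0 : 0 <= Sx n by apply: sumr_ge0.
have xb : xbar n <= 2 * K.
  rewrite /xbar ler_pdivrMr//; apply: (le_trans (hK n n1)).
  by rewrite [2 * K]mulrC -mulrA ler_wpM2l.
have xb0 : 0 <= xbar n by rewrite divr_ge0// ltW.
have Sxx_le : xbar n * Sx n <= 2 * K * K * n%:R.
  by rewrite -mulrA; apply: ler_pM => //; exact: hK.
split=> //; [by rewrite gt_eqF|by rewrite xb0|split; last by rewrite /V; lra].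
apply: (le_trans (hv n (xbar n) n2)).
have -> : \sum_(k < n | w k) (x k - xbar n) ^+ 2 =
    Sxx n - 2 * xbar n * Sx n + xbar n ^+ 2 * S0 n.
  rewrite /Sxx /Sx /S0 !mulr_sumr -!sumrB -!big_split/=.
  by apply: eq_bigr => k _; ring.
have e : xbar n * S0 n = Sx n by rewrite /xbar mulfVK// gt_eqF.
have e2 : xbar n ^+ 2 * S0 n = xbar n * Sx n by rewrite -e; ring.
by rewrite e2 /V; lra.
Qed.

(** The minimum over [v] is [- B^2 / S], where [S >= n / 2] and [B^2 <= delta^2 n^2]. *)
Lemma quad_small (delta B n S v : R) : 0 <= delta -> n <= 2 * S -> 1 <= n ->
  `|B| <= delta * n -> - 2 * delta ^+ 2 * n <= S * v ^+ 2 - 2 * v * B.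
Proof.
move=> d0 nS n1 Bd.
have h1 : v * B <= `|v| * (delta * n).
  by apply: le_trans (ler_norm _) _; rewrite normrM ler_wpM2l.
have h2 : n / 2 * v ^+ 2 <= S * v ^+ 2 by rewrite ler_wpM2r ?sqr_ge0//; lra.
have h3 : 0 <= n * (`|v| - 2 * delta) ^+ 2 by rewrite mulr_ge0 ?sqr_ge0//; lra.
have h4 : v ^+ 2 = `|v| ^+ 2 by rewrite real_normK ?num_real.
rewrite h4 in h2 *.
have -> : - 2 * delta ^+ 2 * n = n / 2 * `|v| ^+ 2 - 2 * (`|v| * (delta * n)) - n * (`|v| - 2 * delta) ^+ 2 / 2.
  by field.
lra.
Qed.

Lemma quad_root (u b c : R) : 0 <= b -> 0 <= c ->
  u ^+ 2 <= 2 * b * `|u| + c * b ^+ 2 -> `|u| <= b * (2 + c).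
Proof.
move=> b0 c0; rewrite -(real_normK (num_real u)) => h.
rewrite leNgt; apply/negP => hu.
have u0 : 0 <= `|u| by [].
move: (`|u|) u0 h hu => t t0 h hu.
have bt : b <= t by nra.
have h1 : b * (2 + c) * t <= t * t by rewrite ler_wpM2r// ltW.
have h2 : c * b * b <= c * b * t by rewrite ler_wpM2l// mulr_ge0.
have [t1|t1] := eqVneq t 0; first by rewrite t1 in hu; have := mulr_ge0 b0 c0; lra.
have tp : 0 < t by rewrite lt0r t1.
have h3 : b * (2 + c) * t < t * t by rewrite ltr_pM2r.
lra.
Qed.

(** The slope is handled first, against the true parameters. Only once it is known to be bounded
    does the competitor for the intercept, which keeps the slope of [p], have an outlier loss
    bounded independently of [n]. *)
Lemma minimizer_close (eta : R) : 0 < eta -> exists N, forall n, (N <= n)%N ->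
  forall p, (forall q, lsq_loss n p <= lsq_loss n q) ->
  `|p.1.1.1 - alpha| <= eta /\ `|p.1.1.2 - mu| <= eta.
Proof.
move=> eta0.
have [K [v [N1 [K0 v0 hN1]]]] := design.
(* Chosen so that the centred cross sum [Sxm n - xbar n * Sm n] is at most [delta * B * V n], using
   [n <= V n / v]. *)
pose B := 1 + (1 + 2 * K * K + 2 * K) / v.
have B1 : 1 <= B by rewrite lerDl divr_ge0 ?(ltW v0)// !addr_ge0// !mulr_ge0.
pose C0 := outlier_loss y11 y12 y13 alpha mu 0 + outlier_loss y21 y22 y23 alpha mu 0.
have [C1 C10 hC1] := outlier_loss0_bound y11 y12 y13 (`|alpha| + 1) (`|mu| + 2 * K).
have [C2 C20 hC2] := outlier_loss0_bound y21 y22 y23 (`|alpha| + 1) (`|mu| + 2 * K).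
pose eta1 := Num.min 1 (eta / (2 * (2 * K + 1))).
have K1 : 0 < 2 * (2 * K + 1) by rewrite mulr_gt0// ltr_wpDl// mulr_ge0.
have eta10 : 0 < eta1 by rewrite lt_min ltr01 divr_gt0.
have e11 : eta1 <= 1 by rewrite ge_min lexx.
have e12 : eta1 * (2 * (2 * K + 1)) <= eta.
  by rewrite -ler_pdivlMr// ge_min lexx orbT.
(* The 3 collects [2 delta^2 n] from [quad_small] and [delta^2 n] from the outlier terms; [1 / v]
   converts [n] into [V n]. *)
pose c := 3 / v.
have c0 : 0 <= c by rewrite divr_ge0// ltW.
have BC : 0 < B * (2 + c).
  by rewrite mulr_gt0//; [exact: lt_le_trans B1|rewrite ltr_pwDl].
pose delta := Num.min (eta1 / (B * (2 + c))) (eta / 10).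
have d0 : 0 < delta by rewrite lt_min !divr_gt0.
have d1 : delta * (B * (2 + c)) <= eta1 by rewrite -ler_pdivlMr// ge_min lexx.
have d2 : delta <= eta / 10 by rewrite ge_min lexx orbT.
have [N2 hN2] := dev_small d0.
have [N3 hN3] := @nat_large _ (C0 + C1 + C2) (delta ^+ 2) (exprn_gt0 2 d0).
exists (maxn N1 (maxn N2 N3)) => n; rewrite !geq_max => /andP[n1 /andP[n2 n3]] p pmin.
have [nge1 nS0 S0n /andP[xb0 xbK] [Vn SxxV]] := hN1 n n1.
have [hm hxm] := hN2 n n2.
have hC := hN3 n n3.
have C00 : 0 <= C0 by rewrite addr_ge0// outlier_loss_ge0.
set u := p.1.1.1 - alpha; set t := p.1.1.2 - mu.
have aE : p.1.1.1 = alpha + u by rewrite /u; ring.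
have mE : p.1.1.2 = mu + t by rewrite /t; ring.
have V0 : 0 <= V n by apply: le_trans Vn; rewrite mulr_ge0 ?(ltW v0)//; lra.
have e : xbar n * S0 n = Sx n by rewrite /xbar mulfVK.
(* Centring the regressor: in the variables [u] and [t'] the quadratic form has no cross term. *)
pose t' := t + u * xbar n.
have rss : \sum_(k < n | w k) (x k.+1 - p.1.1.1 * x k - p.1.1.2) ^+ 2 =
    Smm n - 2 * u * (Sxm n - xbar n * Sm n) + u ^+ 2 * V n + (S0 n * t' ^+ 2 - 2 * t' * Sm n).
  by rewrite aE mE rssE /V /t' -e; ring.
have hD : `|Sxm n - xbar n * Sm n| <= delta * B * V n.
  apply: le_trans (ler_normB _ _) _.
  have h1 : `|xbar n * Sm n| <= 2 * K * (delta * n%:R).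
    by rewrite normrM ger0_norm//; apply: ler_pM.
  have h2 : delta * Sxx n <= delta * (V n + 2 * K * K * n%:R) by apply: ler_wpM2l => //; exact: ltW.
  have h3 : n%:R <= V n / v by rewrite ler_pdivlMr// mulrC.
  have h4 : delta * (1 + 2 * K * K + 2 * K) * n%:R <= delta * (1 + 2 * K * K + 2 * K) * (V n / v).
    by apply: ler_wpM2l => //; rewrite mulr_ge0 ?(ltW d0)// !addr_ge0// !mulr_ge0.
  have -> : delta * B * V n = delta * V n + delta * (1 + 2 * K * K + 2 * K) * (V n / v).
    by rewrite /B; field; rewrite gt_eqF.
  by move: h1 h2 h4 hxm; clear_ineqs; lra.
have uD : u * (Sxm n - xbar n * Sm n) <= `|u| * (delta * B * V n).
  by apply: le_trans (ler_norm _) _; rewrite normrM ler_wpM2l.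
have g1 := outlier_loss_ge0 y11 y12 y13 p.1.1.1 p.1.1.2 p.1.2.
have g2 := outlier_loss_ge0 y21 y22 y23 p.1.1.1 p.1.1.2 p.2.
have qs := quad_small t' (ltW d0) nS0 nge1 hm.
have hu : `|u| <= eta1.
  apply: le_trans d1; rewrite mulrA; apply: quad_root => //.
    by rewrite mulr_ge0 ?(ltW d0)//; exact: le_trans B1.
  have := pmin (alpha, mu, 0, 0); rewrite /lsq_loss rss /=.
  have -> : \sum_(k < n | w k) (x k.+1 - alpha * x k - mu) ^+ 2 = Smm n.
    by apply: eq_bigr => k _; rewrite /m; ring.
  move=> h.
  have Vp : 0 < V n by apply: lt_le_trans Vn; rewrite mulr_gt0//; exact: lt_le_trans nge1.
  rewrite -(ler_pM2r Vp).
  have h5 : 3 * delta ^+ 2 * n%:R <= c * (delta * B) ^+ 2 * V n.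
    have -> : c * (delta * B) ^+ 2 * V n = 3 * delta ^+ 2 * (B ^+ 2 * (V n / v)).
      by rewrite /c; field; rewrite gt_eqF.
    apply: ler_wpM2l; first by rewrite mulr_ge0// sqr_ge0.
    have h6 : n%:R <= V n / v by rewrite ler_pdivlMr// mulrC.
    by apply: (le_trans h6); rewrite ler_peMl ?exprn_ege1// divr_ge0// ltW.
  have : C0 <= delta ^+ 2 * n%:R by move: hC C10 C20; clear_ineqs; lra.
  rewrite /C0 => h7.
  by rewrite mulrDl; move: h h5 h7 uD qs g1 g2; clear_ineqs; lra.
have ht' : `|t'| <= eta / 2.
  (* The competitor with the same slope and [t' = 0]: the slope terms cancel, leaving a quadratic in
     [t'] alone. *)
  have := pmin (p.1.1.1, mu - u * xbar n, 0, 0); rewrite /lsq_loss /= rss.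
  have -> : \sum_(k < n | w k) (x k.+1 - p.1.1.1 * x k - (mu - u * xbar n)) ^+ 2 =
     Smm n - 2 * u * (Sxm n - xbar n * Sm n) + u ^+ 2 * V n.
    by rewrite aE rssE /V -e; ring.
  have b1 : `|p.1.1.1| <= `|alpha| + 1.
    by rewrite aE; apply: le_trans (ler_normD _ _) _; rewrite lerD2l; exact: le_trans e11.
  have b2 : `|mu - u * xbar n| <= `|mu| + 2 * K.
    apply: le_trans (ler_normB _ _) _; rewrite lerD2l normrM (ger0_norm xb0).
    by rewrite -[leRHS]mul1r; apply: ler_pM => //; exact: le_trans e11.
  have h1 := hC1 _ _ b1 b2; have h2 := hC2 _ _ b1 b2 => h.
  have h3 : S0 n * t' ^+ 2 - 2 * t' * Sm n <= delta ^+ 2 * n%:R by move: h h1 h2 g1 g2 hC C00; clear_ineqs; lra.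
  have h4 : t' * Sm n <= `|t'| * (delta * n%:R).
    by apply: le_trans (ler_norm _) _; rewrite normrM ler_wpM2l.
  have h5 : n%:R / 2 * t' ^+ 2 <= S0 n * t' ^+ 2 by rewrite ler_wpM2r ?sqr_ge0// ler_pdivrMr// mulrC.
  have h6 : t' ^+ 2 <= 2 * (2 * delta) * `|t'| + (1 / 2) * (2 * delta) ^+ 2.
    have np : 0 < n%:R / 2 :> R by rewrite divr_gt0//; exact: lt_le_trans nge1.
    by rewrite -(ler_pM2l np); move: h3 h4 h5; clear_ineqs; lra.
  have dd : 0 <= 2 * delta by rewrite mulr_ge0// ltW.
  have := quad_root dd (divr_ge0 ler01 (ler0n R 2)) h6.
  by move: d2; clear_ineqs; lra.
split; first by apply: (le_trans hu); apply: le_trans e12; rewrite ler_peMr ?(ltW eta10)//; move: K0; clear_ineqs; lra.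
have -> : t = t' - u * xbar n by rewrite /t'; ring.
apply: le_trans (ler_normB _ _) _.
have h1 : `|u * xbar n| <= eta1 * (2 * K).
  by rewrite normrM (ger0_norm xb0); apply: ler_pM.
by move: h1 ht' e12 eta10; clear_ineqs; lra.
Qed.

(** * Uniqueness, existence and convergence of minimizers *)

Definition minimizes n (p : par4 R) := forall q, lsq_loss n p <= lsq_loss n q.

Lemma minimizer_fit n p : minimizes n p ->
  p.1.2 = outlier_fit y11 y12 y13 p.1.1.1 p.1.1.2 /\
  p.2 = outlier_fit y21 y22 y23 p.1.1.1 p.1.1.2.
Proof.
have sq_zero (c z : R) : (1 + c ^+ 2) * z ^+ 2 <= 0 -> z = 0.
  by rewrite pmulr_rle0 ?sqr1D_gt0// => z2; apply/eqP; rewrite -sqrf_eq0 eq_le z2 sqr_ge0.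
move=> pmin; split; apply/eqP; rewrite -subr_eq0; apply/eqP; apply: (@sq_zero p.1.1.1).
- have := pmin (p.1.1, outlier_fit y11 y12 y13 p.1.1.1 p.1.1.2, p.2).
  rewrite /lsq_loss/= [outlier_loss _ _ _ _ _ p.1.2]outlier_lossE; lra.
- have := pmin (p.1, outlier_fit y21 y22 y23 p.1.1.1 p.1.1.2).
  rewrite /lsq_loss/= [outlier_loss _ _ _ _ _ p.2]outlier_lossE; lra.
Qed.

Lemma outlier_fit_bound (y1 y2 y3 A M a b : R) : `|a| <= A -> `|b| <= M ->
  `|outlier_fit y1 y2 y3 a b| <= `|y2| + A * `|y1| + M + A * (`|y3| + A * `|y2| + M).
Proof.
move=> aA bM.
have h (u v : R) : `|u - a * v - b| <= `|u| + A * `|v| + M.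
  apply: le_trans (ler_normB _ _) _; apply: lerD => //.
  apply: le_trans (ler_normB _ _) _; apply: lerD => //.
  by rewrite normrM ler_wpM2r.
rewrite normrM normfV (gtr0_norm (sqr1D_gt0 a)) ler_pdivrMr ?sqr1D_gt0//.
apply: (@le_trans _ _ (`|y2| + A * `|y1| + M + A * (`|y3| + A * `|y2| + M))).
  apply: le_trans (ler_normB _ _) _; apply: lerD => //.
  by rewrite normrM; apply: ler_pM.
rewrite ler_peMr//; last by rewrite lerDl sqr_ge0.
have A0 : 0 <= A by exact: le_trans aA.
have M0 : 0 <= M by exact: le_trans bM.
by rewrite !(addr_ge0, mulr_ge0).
Qed.

Lemma rss_centered n (u r : R) : S0 n != 0 ->
  u ^+ 2 * Sxx n + 2 * u * r * Sx n + r ^+ 2 * S0 n =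
  u ^+ 2 * V n + S0 n * (r + u * xbar n) ^+ 2.
Proof.
move=> S0n; have e : xbar n * S0 n = Sx n by rewrite /xbar mulfVK.
by rewrite /V -e; ring.
Qed.

(** Compare two minimizers with their midpoint. Both lie in a box independent of [n], by
    [minimizer_close] and [outlier_fit_bound], so the convexity defect has a constant [C]
    independent of [n], while the regression part gains terms with coefficients of order at least
    [n]. *)
Lemma minimizer_unique : exists N, forall n, (N <= n)%N ->
  forall p p', minimizes n p -> minimizes n p' -> p = p'.
Proof.
have half (a b : R) : (a - b) / 2 = 0 -> a = b by lra.
have [K [v [N1 [K0 v0 hN1]]]] := design.
have [N2 hN2] := minimizer_close ltr01.
pose A := `|alpha| + 1.
pose M0 := `|mu| + 1.
pose T (y1 y2 y3 : R) : R := `|y2| + A * `|y1| + M0 + A * (`|y3| + A * `|y2| + M0).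
have A0 : 0 <= A by rewrite addr_ge0.
have M00 : 0 <= M0 by rewrite addr_ge0.
have T0 (y1 y2 y3 : R) : 0 <= T y1 y2 y3 by rewrite /T !(addr_ge0, mulr_ge0).
pose M := M0 + T y11 y12 y13 + T y21 y22 y23.
have TM1 : T y11 y12 y13 <= M by have := T0 y21 y22 y23; rewrite /M; lra.
have TM2 : T y21 y22 y23 <= M by have := T0 y11 y12 y13; rewrite /M; lra.
have M0M : M0 <= M by have := T0 y21 y22 y23; have := T0 y11 y12 y13; rewrite /M; lra.
have [C1 C10 hC1] := outlier_loss_midpoint y11 y12 y13 A M.
have [C2 C20 hC2] := outlier_loss_midpoint y21 y22 y23 A M.
pose C := C1 + C2.
have C0 : 0 <= C by rewrite addr_ge0.
(* The defect is [C (u^2 + r^2)] with [r^2 <= 2 r'^2 + 8 K^2 u^2]; these thresholds make [2 S0 n]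
   and [V n] exceed the resulting coefficients of [r'^2] and [u^2] by at least 1. *)
have [N3 hN3] := @nat_large _ (2 * C + 1) 1 ltr01.
have [N4 hN4] := @nat_large _ (C * (1 + 8 * K ^+ 2) + 1) v v0.
exists (maxn N1 (maxn N2 (maxn N3 N4))) => n.
rewrite !geq_max => /andP[n1 /andP[n2 /andP[n3 n4]]] p p' pmin pmin'.
have [nge1 nS0 S0n /andP[xb0 xbK] [Vn _]] := hN1 n n1.
have bounds z : minimizes n z ->
    [/\ `|z.1.1.1| <= A, `|z.1.1.2| <= M, `|z.1.2| <= M & `|z.2| <= M].
  move=> zmin; have [ha hm] := hN2 n n2 z zmin.
  have zA : `|z.1.1.1| <= A.
    have -> : z.1.1.1 = alpha + (z.1.1.1 - alpha) by ring.
    by apply: le_trans (ler_normD _ _) _; rewrite lerD2l.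
  have zM : `|z.1.1.2| <= M0.
    have -> : z.1.1.2 = mu + (z.1.1.2 - mu) by ring.
    by apply: le_trans (ler_normD _ _) _; rewrite lerD2l.
  have [-> ->] := minimizer_fit zmin; split=> //; first exact: le_trans M0M.
  - by apply: le_trans TM1; exact: outlier_fit_bound.
  - by apply: le_trans TM2; exact: outlier_fit_bound.
have [bA bM bT1 bT2] := bounds p pmin; have [bA' bM' bT1' bT2'] := bounds p' pmin'.
pose q : par4 R := ((p.1.1.1 + p'.1.1.1) / 2, (p.1.1.2 + p'.1.1.2) / 2,
  (p.1.2 + p'.1.2) / 2, (p.2 + p'.2) / 2).
have hq := pmin q; have hq' := pmin' q.
have h1 := hC1 _ _ _ _ _ _ bA bM bT1 bA' bM' bT1'.
have h2 := hC2 _ _ _ _ _ _ bA bM bT2 bA' bM' bT2'.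
set u := (p.1.1.1 - p'.1.1.1) / 2 in h1 h2.
set r := (p.1.1.2 - p'.1.1.2) / 2 in h1 h2.
set s := (p.1.2 - p'.1.2) / 2 in h1; set s' := (p.2 - p'.2) / 2 in h2.
have rss : \sum_(k < n | w k) (x k.+1 - p.1.1.1 * x k - p.1.1.2) ^+ 2 +
    \sum_(k < n | w k) (x k.+1 - p'.1.1.1 * x k - p'.1.1.2) ^+ 2 =
    2 * (\sum_(k < n | w k) (x k.+1 - q.1.1.1 * x k - q.1.1.2) ^+ 2) +
    2 * (u ^+ 2 * Sxx n + 2 * u * r * Sx n + r ^+ 2 * S0 n).
  rewrite /Sxx /Sx /S0 !mulr_sumr -!big_split/= mulr_sumr -big_split/=.
  by apply: eq_bigr => k _; rewrite /u /r; field.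
rewrite rss_centered// in rss.
set r' := r + u * xbar n in rss.
have key : 2 * (u ^+ 2 * V n + S0 n * r' ^+ 2) + (u * y11 + r + s) ^+ 2 +
    (u * y21 + r + s') ^+ 2 <= C * (u ^+ 2 + r ^+ 2).
  by move: hq hq' h1 h2; rewrite /lsq_loss /C /=; clear_ineqs; move: rss => /=; lra.
have r2 : r ^+ 2 <= 2 * r' ^+ 2 + 8 * K ^+ 2 * u ^+ 2.
  have -> : r = r' - u * xbar n by rewrite /r'; ring.
  have xb2 : xbar n ^+ 2 <= (2 * K) ^+ 2 by rewrite lerXn2r ?nnegrE//; apply: mulr_ge0.
  have hu : u ^+ 2 * xbar n ^+ 2 <= u ^+ 2 * (2 * K) ^+ 2 by rewrite ler_wpM2l ?sqr_ge0.
  have := sqr_ge0 (r' + u * xbar n); move: hu; clear_ineqs; lra.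
have Cr : C * r ^+ 2 <= C * (2 * r' ^+ 2 + 8 * K ^+ 2 * u ^+ 2) by rewrite ler_wpM2l.
have Vu : u ^+ 2 * (C * (1 + 8 * K ^+ 2) + 1) <= u ^+ 2 * V n.
  by rewrite ler_wpM2l ?sqr_ge0//; apply: le_trans (hN4 n n4) Vn.
have Sr : (2 * C + 1) * r' ^+ 2 <= 2 * S0 n * r' ^+ 2.
  by rewrite ler_wpM2r ?sqr_ge0//; have := hN3 n n3; rewrite mul1r; move: nS0; clear_ineqs; lra.
have sum0 : u ^+ 2 + r' ^+ 2 + (u * y11 + r + s) ^+ 2 + (u * y21 + r + s') ^+ 2 <= 0.
  have := sqr_ge0 u; have : 0 <= C * u ^+ 2 by rewrite mulr_ge0 ?sqr_ge0.
  have : 0 <= C * K ^+ 2 * u ^+ 2 by apply: mulr_ge0; [apply: mulr_ge0 => //|]; exact: sqr_ge0.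
  by move: key Cr Vu Sr; clear_ineqs; lra.
have := sqr_ge0 u; have := sqr_ge0 r'.
have := sqr_ge0 (u * y11 + r + s); have := sqr_ge0 (u * y21 + r + s') => q4 q3 q2 q1.
have sq0 (z : R) : z ^+ 2 <= 0 -> z = 0.
  by move=> z2; apply/eqP; rewrite -sqrf_eq0 eq_le z2 sqr_ge0.
clear hq hq' h1 h2 rss key r2 Cr Vu Sr.
have u0 : u = 0 by apply: sq0; move: sum0 q1 q2 q3 q4; clear_ineqs; lra.
have r'0 : r' = 0 by apply: sq0; move: sum0 q1 q2 q3 q4; clear_ineqs; lra.
have z1 : u * y11 + r + s = 0 by apply: sq0; move: sum0 q1 q2 q3 q4; clear_ineqs; lra.
have z2 : u * y21 + r + s' = 0 by apply: sq0; move: sum0 q1 q2 q3 q4; clear_ineqs; lra.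
have r0 : r = 0 by move: r'0; rewrite /r' u0 mul0r addr0.
have s0 : s = 0 by move: z1; rewrite u0 r0 mul0r !add0r.
have s'0 : s' = 0 by move: z2; rewrite u0 r0 mul0r !add0r.
move: u0 r0 s0 s'0; rewrite /u /r /s /s' => /half eu /half er /half es /half es'.
rewrite (surjective_pairing p) (surjective_pairing p.1) (surjective_pairing p.1.1) eu er es es'.
by rewrite -!surjective_pairing.
Qed.

Lemma continuous_lsq_loss n : continuous (lsq_loss n).
Proof.
have cD (T : topologicalType) (f g : T -> R) : continuous f -> continuous g ->
    continuous (fun z => f z + g z) by move=> cf cg z; apply: cvgD; [exact: cf|exact: cg].
have cB (T : topologicalType) (f g : T -> R) : continuous f -> continuous g ->
    continuous (fun z => f z - g z) by move=> cf cg z; apply: cvgB; [exact: cf|exact: cg].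
have cM (T : topologicalType) (f g : T -> R) : continuous f -> continuous g ->
    continuous (fun z => f z * g z) by move=> cf cg z; apply: cvgM; [exact: cf|exact: cg].
have cC (T : topologicalType) (c : R) : continuous (fun _ : T => c) by move=> z; exact: cvg_cst.
have c1 : continuous (fun z : par4 R => z.1) by move=> z; exact: cvg_fst.
have ca : continuous (fun z : par4 R => z.1.1.1).
  move=> z; apply: (@continuous_comp _ _ _ (fun z : par4 R => z.1.1) fst); last exact: cvg_fst.
  by apply: (@continuous_comp _ _ _ (fun z : par4 R => z.1) fst); exact: cvg_fst.
have cm : continuous (fun z : par4 R => z.1.1.2).
  move=> z; apply: (@continuous_comp _ _ _ (fun z : par4 R => z.1.1) snd); last exact: cvg_snd.
  by apply: (@continuous_comp _ _ _ (fun z : par4 R => z.1) fst); exact: cvg_fst.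
have ct1 : continuous (fun z : par4 R => z.1.2).
  move=> z; apply: (@continuous_comp _ _ _ (fun z : par4 R => z.1) snd); last exact: cvg_snd.
  exact: cvg_fst.
have ct2 : continuous (fun z : par4 R => z.2) by move=> z; exact: cvg_snd.
have csum : continuous (fun p : par4 R =>
    \sum_(k < n | w k) (x k.+1 - p.1.1.1 * x k - p.1.1.2) ^+ 2).
  apply: continuous_big => [z|k _]; first exact: add_continuous.
  by apply: (cM _); apply: (cB _) => //; apply: (cB _) => //; apply: (cM _).
have closs (y1 y2 y3 : R) (t : par4 R -> R) : continuous t ->
    continuous (fun z : par4 R => outlier_loss y1 y2 y3 z.1.1.1 z.1.1.2 (t z)).
  move=> ct.
  have e1 := cB _ _ _ (cB _ _ _ (cB _ _ _ (cC _ y2) (cM _ _ _ ca (cC _ y1))) cm) ct.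
  have e2 := cD _ _ _ (cB _ _ _ (cB _ _ _ (cC _ y3) (cM _ _ _ ca (cC _ y2))) cm) (cM _ _ _ ca ct).
  exact: (cD _ _ _ (cM _ _ _ e1 e1) (cM _ _ _ e2 e2)).
exact: (cD _ _ _ (cD _ _ _ csum (closs _ _ _ _ ct1)) (closs _ _ _ _ ct2)).
Qed.

(** Coercivity: parameters doing at least as well as [p0] lie in a compact box. Positive [V n] and
    [S0 n] bound slope and intercept, and these bound the outlier sizes. *)
Lemma minimizer_exists : exists N, forall n, (N <= n)%N -> exists p, minimizes n p.
Proof.
have [K [v [N [K0 v0 hN]]]] := design; exists N => n Nn.
have [nge1 nS0 S0n /andP[xb0 xbK] [Vn _]] := hN n Nn.
have S0p : 0 < S0 n by lra.
have Vp : 0 < V n by apply: lt_le_trans Vn; rewrite mulr_gt0//; lra.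
pose p0 : par4 R := (alpha, mu, 0, 0).
pose M := lsq_loss n p0.
pose D := Sxm n - xbar n * Sm n.
pose E := M + 2 * D ^+ 2 / V n + 2 * Sm n ^+ 2 / S0 n.
have rss0 (z : par4 R) : 0 <= \sum_(k < n | w k) (x k.+1 - z.1.1.1 * x k - z.1.1.2) ^+ 2.
  by apply: sumr_ge0 => k _; exact: sqr_ge0.
have le1sq (z c : R) : z ^+ 2 <= c -> `|z| <= 1 + c.
  by rewrite -(real_normK (num_real z)) => ?; have := sqr_ge0 (`|z| - 1); nra.
pose U := 1 + 2 * E / V n.
pose W := 1 + 2 * E / S0 n + U * xbar n.
pose TT (y1 y2 : R) : R := `|y2| + (`|alpha| + U) * `|y1| + (`|mu| + W) + (1 + M).
have sub z : lsq_loss n z <= M ->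
   [/\ `|z.1.1.1| <= `|alpha| + U, `|z.1.1.2| <= `|mu| + W,
       `|z.1.2| <= TT y11 y12 & `|z.2| <= TT y21 y22].
  move=> zM.
  have g1 := outlier_loss_ge0 y11 y12 y13 z.1.1.1 z.1.1.2 z.1.2.
  have g2 := outlier_loss_ge0 y21 y22 y23 z.1.1.1 z.1.1.2 z.2.
  have g0 := rss0 z; move: zM; rewrite /lsq_loss => zM.
  set u := z.1.1.1 - alpha; set r := z.1.1.2 - mu.
  have aE : z.1.1.1 = alpha + u by rewrite /u; ring.
  have mE : z.1.1.2 = mu + r by rewrite /r; ring.
  pose r' := r + u * xbar n.
  have rssz : \sum_(k < n | w k) (x k.+1 - z.1.1.1 * x k - z.1.1.2) ^+ 2 =
      Smm n - 2 * u * D + u ^+ 2 * V n + (S0 n * r' ^+ 2 - 2 * r' * Sm n).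
    have e : xbar n * S0 n = Sx n by rewrite /xbar mulfVK.
    by rewrite aE mE rssE /D /V /r' -e; ring.
  have Smm0 : 0 <= Smm n by apply: sumr_ge0 => k _; exact: sqr_ge0.
  have sq1 : - (2 * D ^+ 2 / V n) <= u ^+ 2 * V n / 2 - 2 * u * D.
    rewrite -subr_ge0 [leRHS](_ : _ = (u * V n - 2 * D) ^+ 2 / (2 * V n)); last first.
      by field; rewrite gt_eqF.
    by rewrite divr_ge0 ?sqr_ge0// mulr_ge0// ltW.
  have sq2 : - (2 * Sm n ^+ 2 / S0 n) <= r' ^+ 2 * S0 n / 2 - 2 * r' * Sm n.
    rewrite -subr_ge0 [leRHS](_ : _ = (r' * S0 n - 2 * Sm n) ^+ 2 / (2 * S0 n)); last first.
      by field.
    by rewrite divr_ge0 ?sqr_ge0// mulr_ge0// ltW.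
  have hE : u ^+ 2 * V n / 2 + r' ^+ 2 * S0 n / 2 <= E.
    by rewrite /E; move: sq1 sq2 zM rssz g1 g2 Smm0; clear_ineqs; lra.
  have hV : 0 <= u ^+ 2 * V n by rewrite mulr_ge0 ?sqr_ge0// ltW.
  have hS : 0 <= r' ^+ 2 * S0 n by rewrite mulr_ge0 ?sqr_ge0// ltW.
  have hu : `|u| <= U by apply: le1sq; rewrite ler_pdivlMr//; move: hE hS; clear_ineqs; lra.
  have hr' : `|r'| <= 1 + 2 * E / S0 n by apply: le1sq; rewrite ler_pdivlMr//; move: hE hV; clear_ineqs; lra.
  have hr : `|r| <= W.
    have -> : r = r' - u * xbar n by rewrite /r'; ring.
    apply: le_trans (ler_normB _ _) _; rewrite lerD//.
    by rewrite normrM (ger0_norm xb0) ler_wpM2r.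
  have ha : `|z.1.1.1| <= `|alpha| + U.
    by rewrite aE; apply: le_trans (ler_normD _ _) _; rewrite lerD2l.
  have hm : `|z.1.1.2| <= `|mu| + W.
    by rewrite mE; apply: le_trans (ler_normD _ _) _; rewrite lerD2l.
  (* Taken from the first square of the outlier loss, where [t] has coefficient -1; in the second
     its coefficient is the slope, which may vanish. *)
  have tbound y1 y2 (c t : R) : (y2 - z.1.1.1 * y1 - z.1.1.2 - t) ^+ 2 <= M -> `|t| <= TT y1 y2.
    move=> /le1sq h.
    have -> : t = (y2 - z.1.1.1 * y1 - z.1.1.2) - (y2 - z.1.1.1 * y1 - z.1.1.2 - t) by ring.
    apply: le_trans (ler_normB _ _) _; rewrite lerD//.
    apply: le_trans (ler_normB _ _) _; rewrite lerD//.
    apply: le_trans (ler_normB _ _) _; rewrite lerD//.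
    by rewrite normrM ler_wpM2r.
  split=> //; apply: (tbound _ _ 0).
  - apply: le_trans zM; rewrite /outlier_loss in g1 g2 *.
    have := sqr_ge0 (y13 - z.1.1.1 * y12 - z.1.1.2 + z.1.1.1 * z.1.2); move: g0 g2; clear_ineqs; lra.
  - apply: le_trans zM; rewrite /outlier_loss in g1 g2 *.
    have := sqr_ge0 (y23 - z.1.1.1 * y22 - z.1.1.2 + z.1.1.1 * z.2); move: g0 g1; clear_ineqs; lra.
pose box (b : R) : set R := `[- b, b]%classic.
pose A : set (par4 R) := box (`|alpha| + U) `*` box (`|mu| + W) `*` box (TT y11 y12) `*` box (TT y21 y22).
have cA : compact A by do 3! [apply: compact_setX; last exact: segment_compact]; exact: segment_compact.
have inA z : lsq_loss n z <= M -> A z.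
  by move=> /sub[]; rewrite !ler_norml /A /box /= !in_itv/=.
have A0 : A !=set0 by exists p0; exact: inA.
have cl : {within A, continuous (lsq_loss n)}.
  by apply: continuous_subspaceT; exact: continuous_lsq_loss.
have [c _ cmin] := compact_EVT_min A0 cA cl.
exists c => z; have [zM|Mz] := leP (lsq_loss n z) M.
  by apply: cmin; rewrite inE; exact: inA.
by apply: le_trans (ltW Mz); apply: cmin; rewrite inE; exact: inA.
Qed.

Lemma minimizer_cvg (est : nat -> par4 R) :
  (exists N, forall n, (N <= n)%N -> minimizes n (est n)) ->
  [/\ (fun n => (est n).1.1.1) @ \oo --> alpha, (fun n => (est n).1.1.2) @ \oo --> mu,
      (fun n => (est n).1.2) @ \oo --> outlier_fit y11 y12 y13 alpha mu &
      (fun n => (est n).2) @ \oo --> outlier_fit y21 y22 y23 alpha mu].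
Proof.
move=> [N hN].
have close (e : R) : 0 < e -> \forall n \near \oo,
    `|alpha - (est n).1.1.1| <= e /\ `|mu - (est n).1.1.2| <= e.
  move=> e0; have [N' hN'] := minimizer_close e0.
  exists (maxn N N') => // n /=; rewrite geq_max => /andP[Nn N'n].
  by rewrite [`|alpha - _|]distrC [`|mu - _|]distrC; exact: (hN' n N'n (est n) (hN n Nn)).
have ca : (fun n => (est n).1.1.1) @ \oo --> alpha.
  by apply/cvgrPdist_le => e /close; apply: filterS => n [].
have cm : (fun n => (est n).1.1.2) @ \oo --> mu.
  by apply/cvgrPdist_le => e /close; apply: filterS => n [].
have cfit (y1 y2 y3 : R) : (fun n => outlier_fit y1 y2 y3 (est n).1.1.1 (est n).1.1.2) @ \oo -->
    outlier_fit y1 y2 y3 alpha mu.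
  have lin (u v : R) : (fun n => u - (est n).1.1.1 * v - (est n).1.1.2) @ \oo --> u - alpha * v - mu.
    by apply: cvgB => //; apply: cvgB; [exact: cvg_cst|apply: cvgM => //; exact: cvg_cst].
  apply: cvgM; first by apply: cvgB; [exact: lin|apply: cvgM => //; exact: lin].
  apply: cvgV; first by rewrite gt_eqF// sqr1D_gt0.
  by apply: cvgD; [exact: cvg_cst|apply: cvgM].
have fitE (g : nat -> R) y1 y2 y3 : (forall n, (N <= n)%N -> g n = outlier_fit y1 y2 y3 (est n).1.1.1 (est n).1.1.2) ->
    g @ \oo --> outlier_fit y1 y2 y3 alpha mu.
  move=> gE; apply: cvg_trans (cfit y1 y2 y3); apply: near_eq_cvg.
  by exists N => // n /= /gE ->.
split=> //; apply: fitE => n /hN /minimizer_fit[]//.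
Qed.
End Regression.

(** * Conclusion *)

Lemma outlier_fitE (R : realType) (y1 y2 y3 a m : R) : outlier_fit y1 y2 y3 a m =
  y2 - a / (1 + a ^+ 2) * (y1 + y3) - (1 - a) / (1 + a ^+ 2) * m.
Proof. by rewrite /outlier_fit; field; rewrite gt_eqF// sqr1D_gt0. Qed.

(** After the shift to [k.+1], a retained index has neither [k] nor [k.+1] at an outlier position,
    so [y] and [x] agree in its summand. *)
Lemma Qn_lsq_loss (R : realType) (s1 s2 n : nat) (x y : nat -> R) (p : par4 R) :
  (forall k, k != s1 -> k != s2 -> y k = x k) ->
  Qn s1 s2 n y p = lsq_loss x (fun k => k.+1 \notin [:: s1; s1.+1; s2; s2.+1])
    (y s1.-1) (y s1) (y s1.+1) (y s2.-1) (y s2) (y s2.+1) n p.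
Proof.
move=> yx; rewrite /Qn /lsq_loss /outlier_loss; congr (_ + _ + _).
rewrite big_add1/= big_mkord; apply: eq_bigr => k.
rewrite !inE !negb_or => /and4P[k1 k2 k3 k4].
by rewrite !yx.
Qed.

Lemma notin_outlier_window (s1 s2 k : nat) : (s1.+1 < s2)%N -> (s2.+1 <= k)%N ->
  k.+1 \notin [:: s1; s1.+1; s2; s2.+1].
Proof. by move=> s12 sk; rewrite !inE !negb_or; apply/and4P; split; lia. Qed.

Theorem theorem3p6p1 (d : measure_display) (T : measurableType d)
  (R : realType) (P : probability T R)
  (alpha : R) (X0 : T -> nat) (eps : nat -> T -> nat)
  (xi : nat -> nat -> T -> nat) (s1 s2 th1 th2 : nat) :
  0 < alpha < 1 ->
  (* all primitive variables are random variables *)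
  (forall i, measurable_fun setT (inar_family X0 eps xi i)) ->
  (* X_0, (eps_k)_{k>=1}, (xi_{k,j})_{k,j>=1} mutually independent *)
  mutually_independent P inar_used (inar_family X0 eps xi) ->
  (* the eps_k are identically distributed *)
  (forall k (A : set nat), (1 <= k)%N ->
     P (eps k @^-1` A) = P (eps 1%N @^-1` A)) ->
  (* xi_{k,j} ~ Bernoulli(alpha) *)
  (forall k j, (1 <= k)%N -> (1 <= j)%N ->
     P (xi k j @^-1` [set 1%N]) = alpha%:E /\
     P (xi k j @^-1` [set 0%N]) = (1 - alpha)%:E) ->
  (* E eps_1^2 < oo and P(eps_1 <> 0) > 0 *)
  (\int[P]_w (((eps 1%N w) ^ 2)%N%:R)%:E < +oo)%E ->
  (0 < P [set w | eps 1%N w <> 0%N])%E ->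
  (* E X_0^2 < oo *)
  (\int[P]_w (((X0 w) ^ 2)%N%:R)%:E < +oo)%E ->
  (* known outlier positions s1 < s2 - 1 in N, sizes in N *)
  (1 <= s1)%N -> (s1.+1 < s2)%N -> (1 <= th1)%N -> (1 <= th2)%N ->
  let mu_eps : R := fine (\int[P]_w ((eps 1%N w)%:R)%:E) in
  {ae P, forall w,
    let y : nat -> R := fun k => (inarY X0 eps xi s1 s2 th1 th2 k w)%:R in
    exists n0 : nat,
      (forall n, (n0 <= n)%N ->
         exists! p : par4 R, forall q : par4 R, Qn s1 s2 n y p <= Qn s1 s2 n y q)
      /\
      (forall est : nat -> par4 R,
         (forall n, (n0 <= n)%N -> forall q : par4 R,
             Qn s1 s2 n y (est n) <= Qn s1 s2 n y q) ->
         [/\ (fun n => (est n).1.1.1) @ \oo --> alpha,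
             (fun n => (est n).1.1.2) @ \oo --> mu_eps,
             (fun n => (est n).1.2) @ \oo -->
                y s1 - alpha / (1 + alpha ^+ 2) * (y s1.-1 + y s1.+1)
                     - (1 - alpha) / (1 + alpha ^+ 2) * mu_eps
           & (fun n => (est n).2) @ \oo -->
                y s2 - alpha / (1 + alpha ^+ 2) * (y s2.-1 + y s2.+1)
                     - (1 - alpha) / (1 + alpha ^+ 2) * mu_eps])}.
Proof.
move=> alpha01 mF indF eps_id xi_law sq_eps eps_nz sq_X0 _ s12 _ _ mu.
have [a0 a1] := andP alpha01.
have m_eps (g : nat -> R) : measurable_fun setT (fun w => (g (eps 1%N w))%:E).
  exact: (measurable_nat_comp (fun n => (g n)%:E) (mF (IEps 1))).
have {}sq_eps : (\int[P]_w ((eps 1%N w)%:R ^+ 2)%:E < +oo)%E.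
  by under eq_integral do rewrite -natrX.
have {}sq_X0 : (\int[P]_w ((X0 w)%:R ^+ 2)%:E < +oo)%E.
  by under eq_integral do rewrite -natrX.
pose m2 : R := fine (\int[P]_w ((eps 1%N w)%:R ^+ 2)%:E).
have sq_ge0 : (0 <= \int[P]_w ((eps 1%N w)%:R ^+ 2)%:E)%E.
  by apply: integral_ge0 => w _; rewrite lee_fin sqr_ge0.
have sqmean : (\int[P]_w ((eps 1%N w)%:R ^+ 2)%:E = m2%:E)%E.
  by rewrite /m2 fineK// ge0_fin_numE.
have mu_ge0 : (0 <= \int[P]_w ((eps 1%N w)%:R)%:E)%E.
  by apply: integral_ge0 => w _; rewrite lee_fin.
have mean : (\int[P]_w ((eps 1%N w)%:R)%:E = mu%:E)%E.
  rewrite /mu fineK// ge0_fin_numE//; apply: le_lt_trans sq_eps.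
  apply: ge0_le_integral => //.
  - exact: (m_eps (fun n => n%:R ^+ 2)).
  by move=> w _; rewrite lee_fin -natrX ler_nat; case: (eps 1%N w) => // n; exact: leq_pmull.
have mu0 : 0 <= mu by exact: fine_ge0.
have s20 := s2_ge0 alpha01 mF mean sqmean.
set s2' := m2 - mu ^+ 2 in s20.
pose p0 := fine (P (eps 1%N @^-1` [set 0%N])).
have p01 : p0 < 1.
  have mE B := measurable_preimage_nat B (mF (IEps 1)).
  have eP : P [set w | eps 1%N w <> 0%N] = (1 - P (eps 1%N @^-1` [set 0%N]))%E.
    by rewrite -probability_setC//; exact: mE.
  move: eps_nz; rewrite eP.
  rewrite -(@fineK _ (P (eps 1%N @^-1` [set 0%N]))); last by rewrite fin_num_measure//; exact: mE.
  by rewrite -EFinB lte_fin subr_gt0.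
(* The largest value allowed by [trans_prob_stay]; it is positive because the innovation is nonzero
   with positive probability. *)
pose q := Num.min alpha (Num.min (1 - alpha) (1 - p0)).
have q0 : 0 < q by rewrite !lt_min a0 !subr_gt0 a1 p01.
have qa : q <= alpha by rewrite ge_min lexx.
have qa' : q <= 1 - alpha by rewrite !ge_min lexx orbT.
have qp : p0 <= 1 - q.
  have : q <= 1 - p0 by rewrite !ge_min lexx !orbT.
  by lra.
have jump := ae_exp_bound alpha01 mF indF eps_id xi_law
  (f := fun _ x y => q / 2 - (y != x)%:R)
  (fun _ x => kernel_jump_le1 alpha01 mF x (ltW q0) qa qa' qp).
have dev (phi : nat -> R) := ae_exp_bound alpha01 mF indF eps_id xi_law
  (f := fun n x y => trunc_half (phi x / rho R n ^+ 38 * (y%:R - cmean alpha mu x%:R)) -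
    2 * (phi x / rho R n ^+ 38) ^+ 2 * cvar alpha mu m2 x%:R)
  (fun n x => kernel_expR_le1 alpha01 mF mean sqmean (phi x / rho R n ^+ 38) x).
have growth := ae_sq_growth alpha01 mF indF eps_id xi_law mean sqmean sq_X0.
(* Six almost sure events: jumps, growth, and both signs of the plain and the weighted residual
   sums. From here on the path is fixed. *)
apply: filterS (filterI (filterI jump growth)
  (filterI (filterI (dev (fun=> 1)) (dev (fun=> -1)))
           (filterI (dev (fun n => n%:R)) (dev (fun n => - n%:R))))).
move=> w [[jw gw] [[d1 d2] [d3 d4]]].
pose y k : R := (inarY X0 eps xi s1 s2 th1 th2 k w)%:R; rewrite -/y.
pose x k : R := (inarX X0 eps xi k w)%:R.
have {}d1 : dev_bound alpha mu s2' x (fun=> 1) by [].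
have {}d2 : dev_bound alpha mu s2' x (fun=> -1) by [].
have {}d3 : dev_bound alpha mu s2' x x by [].
have {}d4 : dev_bound alpha mu s2' x (fun k => - x k) by [].
have x0 k : 0 <= x k by rewrite /x.
have xj k : x k.+1 != x k -> 1 <= (x k.+1 - x k) ^+ 2.
  rewrite /x eqr_nat; set a := inarX _ _ _ _ _; set b := inarX _ _ _ _ _ => ab.
  case: (ltngtP a b) ab => // ab _.
    have : a%:R + 1 <= b%:R :> R by rewrite natr1 ler_nat.
    by nra.
  have : b%:R + 1 <= a%:R :> R by rewrite natr1 ler_nat.
  by nra.
have jx : exists C : R, forall n, \sum_(k < n) (q / 2 - (x k.+1 != x k)%:R) <= C + 48 * rho R n.
  have [C hC] := jw; exists C => n; apply: le_trans (hC n).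
  by apply: ler_sum => k _; rewrite /x eqr_nat.
pose wt k := k.+1 \notin [:: s1; s1.+1; s2; s2.+1].
have wL k : (s2.+1 <= k)%N -> wt k.
  exact: notin_outlier_window.
have R1 := dev_w_small alpha01 mu0 s20 x0 gw d1 d2 d3 d4 wL.
have R2 := sum_w_x_linear alpha01 mu0 s20 x0 gw d1 d2 d3 d4 wt.
have R3 := sum_w_spread q0 xj jx wL.
have R0 := count_w_linear R wL.
have yx k : k != s1 -> k != s2 -> y k = x k.
  by move=> /negPf ks1 /negPf ks2; rewrite /y /inarY ks1 ks2 !addn0.
have QE n p := @Qn_lsq_loss R s1 s2 n x y p yx.
have [N1 ex] := minimizer_exists alpha mu x0 R2 R3 R0 (y s1.-1) (y s1) (y s1.+1) (y s2.-1) (y s2) (y s2.+1).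
have [N2 un] := minimizer_unique x0 R1 R2 R3 R0 (y s1.-1) (y s1) (y s1.+1) (y s2.-1) (y s2) (y s2.+1).
have minE n p : (forall q, Qn s1 s2 n y p <= Qn s1 s2 n y q) <->
    minimizes x wt (y s1.-1) (y s1) (y s1.+1) (y s2.-1) (y s2) (y s2.+1) n p.
  by split=> h z; [rewrite -!QE|rewrite !QE].
exists (maxn N1 N2); split=> [n|est hest].
  rewrite geq_max => /andP[n1 n2]; have [p pmin] := ex n n1.
  exists p; split; first exact/minE.
  by move=> p' /minE; exact: (un n n2).
have := @minimizer_cvg R alpha mu x wt x0 R1 R2 R3 R0
  (y s1.-1) (y s1) (y s1.+1) (y s2.-1) (y s2) (y s2.+1) est.
rewrite !outlier_fitE; apply; exists (maxn N1 N2) => n Nn.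
by apply/minE; exact: hest.
Qed.
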